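(* Let $M_1$ and $M_2$ be smooth manifolds (possibly with rough boundary) modelled on locally convex spaces $E_1$ and $E_2$ respectively, $F$ be a locally convex space and $r,s \in \mathbb{N}_0 \cup \{\infty \}$. Assume that (a), (b) or (c) is satisfied: (a) $M_2$ is a finite-dimensional manifold with corners (with no further assumptions on the space $E_1$). (b) $E_1$ and $E_2$ are metrizable. (c) $M_1$ and $M_2$ are manifolds with corners and both $E_1$ and $E_2$ are hemicompact $k$-spaces. Then $$\Phi \colon C^{r,s}(M_1\times M_2,F)\to C^r(M_1,C^s(M_2,F)), \quad f \mapsto f^\vee,\qquad f^\vee(x):=f(x,\bullet),$$ is an isomorphism of topological vector spaces. Moreover, a map $g\colon M_1 \to C^s(M_2,F)$ is $C^r$ if and only if $$g^\wedge \colon M_1 \times M_2 \to F,\quad g^\wedge (x,y):= g(x)(y)$$ is $C^{r,s}$.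
   Context: Locally convex spaces are real Hausdorff locally convex topological vector spaces. A subset $U$ of a locally convex space $E$ is called locally convex if every $x\in U$ has a convex neighbourhood in $U$. ''With dense interior'' means that the interior $U^\circ$ is dense in $U$. $C^r$-maps: For $f\colon U\to F$ with $U\subseteq E$ open, $D_hf(x):=\lim_{t\to0}t^{-1}(f(x+th)-f(x))$. The map $f$ is $C^r$ if for all $k\in\mathbb{N}_0$ with $k\le r$ the iterated directional derivatives $d^{(k)}f(x,y_1,\dots,y_k):=(D_{y_k}\cdots D_{y_1}f)(x)$ exist and define a continuous map $d^{(k)}f\colon U\times E^k\to F$. If $U$ is a locally convex subset with dense interior, $f\colon U\to F$ is $C^r$ if $f|_{U^\circ}$ is $C^r$ and each $d^{(k)}(f|_{U^\circ})$ extends to a (unique) continuous map $d^{(k)}f\colon U\times E^k\to F$ (with $d^{(0)}f=f$). Smooth means $C^\infty$. $C^{r,s}$-maps: For $U\subseteq E_1$, $V\subseteq E_2$ open, $f\colon U\times V\to F$ is $C^{r,s}$ if for all $i,j\in\mathbb{N}_0$ with $i\le r$, $j\le s$ the iterated directional derivative $d^{(i,j)}f(x,y,w_1,\dots,w_i,v_1,\dots,v_j):=(D_{(w_i,0)}\cdots D_{(w_1,0)}D_{(0,v_j)}\cdots D_{(0,v_1)}f)(x,y)$ exists everywhere and $d^{(i,j)}f\colon U\times V\times E_1^i\times E_2^j\to F$ is continuous. If $U,V$ are locally convex subsets with dense interior, $f$ is $C^{r,s}$ if $f|_{U^\circ\times V^\circ}$ is $C^{r,s}$ and each $d^{(i,j)}(f|_{U^\circ\times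 V^\circ})$ extends to a continuous map $d^{(i,j)}f\colon U\times V\times E_1^i\times E_2^j\to F$ (with $d^{(0,0)}f=f$). Topologies on sets: $C^r(U,F)$ carries the initial topology with respect to the maps $d^{(k)}\colon C^r(U,F)\to C(U\times E^k,F)$, $k\le r$; $C^{r,s}(U\times V,F)$ carries the initial topology with respect to the maps $d^{(i,j)}\colon C^{r,s}(U\times V,F)\to C(U\times V\times E_1^i\times E_2^j,F)$, $i\le r$, $j\le s$ (spaces of continuous maps with the compact-open topology). Manifolds: A (smooth) manifold with rough boundary modelled on $E$ is a Hausdorff topological space $M$ with an atlas of smoothly compatible homeomorphisms $\phi\colon U_\phi\to V_\phi$ from open subsets $U_\phi\subseteq M$ onto locally convex subsets $V_\phi\subseteq E$ with dense interior. It is a manifold with corners if each $V_\phi$ is a relatively open subset of $\lambda_1^{-1}([0,\infty[)\cap\cdots\cap\lambda_n^{-1}([0,\infty[)$ for suitable $n\in\mathbb{N}$ (which may depend on $\phi$) and linearly independent continuous linear functionals $\lambda_1,\dots,\lambda_n\in E'$. A map $f\colon M\to F$ to a locally convex space is $C^r$ if $f\circ\phi^{-1}\colon V_\phi\to F$ is $C^r$ for all charts $\phi$; $C^r(M,F)$ carries the initial topology with respect to the maps $C^r(M,F)\to C^r(V_\phi,F)$, $f\mapsto f\circ\phi^{-1}$. A map $f\colon M_1\times M_2\to F$ is $C^{r,s}$ if $f\circ(\varphi^{-1}\times\psi^{-1})\colon V_\varphi\times V_\psi\to F$ is $C^{r,s}$ for all charts $\varphi$ of $M_1$ and $\psi$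 of $M_2$; the space $C^{r,s}(M_1\times M_2,F)$ of all such maps carries the initial topology with respect to the maps $C^{r,s}(M_1\times M_2,F)\to C^{r,s}(V_\varphi\times V_\psi,F)$, $f\mapsto f\circ(\varphi^{-1}\times\psi^{-1})$, for $\varphi,\psi$ in the maximal smooth atlases. A topological space $X$ is a k-space if it is Hausdorff and its topology is the final topology with respect to the inclusion maps $K\to X$ of compact subsets. $X$ is hemicompact if it is the union of an ascending sequence $K_1\subseteq K_2\subseteq\cdots$ of compact sets and each compact subset of $X$ is contained in some $K_n$. *)

(* Defs.v *)
From HB Require Import structures.
From mathcomp Require Import all_boot all_order all_algebra.
From mathcomp Require Import all_classical all_reals all_analysis.
Import Order.TTheory GRing.Theory Num.Theory.
Import numFieldNormedType.Exports.

Set Implicit Arguments.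
Unset Strict Implicit.
Unset Printing Implicit Defensive.

Local Open Scope classical_set_scope.
Local Open Scope ring_scope.

(* [tvsType] is locally convex but not necessarily Hausdorff. *)
HB.mixin Record Topological_isHausdorff T & Topological T := {
  is_hausdorff : hausdorff_space T
}.

#[short(type="lcsType")]
HB.structure Definition LocallyConvexSpace (R : realType) :=
  {E of Tvs R E & Topological_isHausdorff E}.

Section DirectionalDerivatives.
Context {R : realType} {E : lmodType R} {F : lcsType R}.
Implicit Types (f : E -> F) (h x : E).

Definition is_dderive f h x (l : F) : Prop :=
  (fun t : R => t^-1 *: (f (x + t *: h) - f x)) @ 0^' --> l.

Definition dderivable f h x : Prop := exists l, is_dderive f h x l.

(* Junk value [0] where the limit does not exist; [tvsType]s are not pointed,
   so that [lim] is not available. *)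
Definition dderive f h x : F := xget 0 [set l | is_dderive f h x l].

(* [iter_dderive f [:: y_1; ...; y_k]] is [D_{y_k} ... D_{y_1} f]. *)
Fixpoint iter_dderive f (hs : seq E) : E -> F :=
  if hs is h :: hs' then iter_dderive (dderive f h) hs' else f.

Fixpoint iter_dderivable (U : set E) f (hs : seq E) : Prop :=
  if hs is h :: hs' then
    (forall x, U x -> dderivable f h x) /\ iter_dderivable U (dderive f h) hs'
  else True.

End DirectionalDerivatives.

(* Orders of differentiability: [None] stands for infinity. *)
Definition order_le (k : nat) (r : option nat) : bool :=
  if r is Some n then (k <= n)%N else true.

Section ContinuousExtension.
Context {R : realType} {X : topologicalType} {F : lcsType R}.

Definition is_cextension (D : set X) (g0 g : X -> F) : Prop :=
  continuous g /\ {in D, g =1 g0}.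

(* Junk value [0] if there is no continuous extension. *)
Definition cextension (D : set X) (g0 : X -> F) : X -> F :=
  xget (fun=> 0) [set g | is_cextension D g0 g].

End ContinuousExtension.

Definition locally_convex_set {R : realType} {E : tvsType R} (U : set E) : Prop :=
  forall x, U x ->
    exists C : set E, [/\ convex_set C, C `<=` U & within U (nbhs x) C].

Definition dense_interior {E : topologicalType} (U : set E) : Prop :=
  U `<=` closure U°.

Section Cr.
Context {R : realType} {E F : lcsType R}.
Variables (V : set E) (f : E -> F) (k : nat).

Definition Cr_dom : topologicalType := (V * {ptws 'I_k -> E})%type.

Definition Cr_dom_int : set Cr_dom := [set p | V° (set_val p.1)].

Definition Cr_dirs (y : 'I_k -> E) : seq E := [seq y i | i : 'I_k].

Definition dk_int (p : Cr_dom) : F :=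
  iter_dderive f (Cr_dirs p.2) (set_val p.1).

(* [d^(k) f : V * E^k -> F] *)
Definition dk : Cr_dom -> F := cextension Cr_dom_int dk_int.

End Cr.
Arguments Cr_dom_int {R E} V k.
Arguments dk_int {R E F} V f k p.
Arguments dk {R E F} V f k p.

(* A map on [V] is represented by [f : E -> F], of which only the restriction
   to [V] matters. Continuity of [f] on [V] expresses that the continuous
   extension [d^(0) f] of the restriction of [f] to the interior is [f]. *)
Definition is_Cr {R : realType} {E F : lcsType R} (r : option nat) (V : set E) (f : E -> F) :=
  {within V, continuous f} /\
  forall k, order_le k r ->
    (forall y : 'I_k -> E, iter_dderivable V° f (Cr_dirs y)) /\
    exists g, is_cextension (Cr_dom_int V k) (dk_int V f k) g.

Section Crs.
Context {R : realType} {E1 E2 F : lcsType R}.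
Variables (V1 : set E1) (V2 : set E2) (f : E1 * E2 -> F) (i j : nat).

Definition Crs_dom : topologicalType :=
  (V1 * V2 * ({ptws 'I_i -> E1} * {ptws 'I_j -> E2}))%type.

Definition Crs_dom_int : set Crs_dom :=
  [set p | V1° (set_val p.1.1) /\ V2° (set_val p.1.2)].

(* [(0,v_1), ..., (0,v_j), (w_1,0), ..., (w_i,0)] *)
Definition Crs_dirs (w : 'I_i -> E1) (v : 'I_j -> E2) : seq (E1 * E2) :=
  [seq (0, v b) | b : 'I_j] ++ [seq (w a, 0) | a : 'I_i].

Definition dij_int (p : Crs_dom) : F :=
  iter_dderive f (Crs_dirs p.2.1 p.2.2) (set_val p.1.1, set_val p.1.2).

(* [d^(i,j) f : V1 * V2 * E1^i * E2^j -> F] *)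
Definition dij : Crs_dom -> F := cextension Crs_dom_int dij_int.

End Crs.
Arguments Crs_dom_int {R E1 E2} V1 V2 i j.
Arguments dij_int {R E1 E2 F} V1 V2 f i j p.
Arguments dij {R E1 E2 F} V1 V2 f i j p.

Definition is_Crs {R : realType} {E1 E2 F : lcsType R} (r s : option nat)
    (V1 : set E1) (V2 : set E2) (f : E1 * E2 -> F) :=
  {within V1 `*` V2, continuous f} /\
  forall i j, order_le i r -> order_le j s ->
    (forall (w : 'I_i -> E1) (v : 'I_j -> E2),
       iter_dderivable (V1° `*` V2°) f (Crs_dirs w v)) /\
    exists g,
      is_cextension (Crs_dom_int V1 V2 i j) (dij_int V1 V2 f i j) g.

Record chart {R : realType} (E : lcsType R) (M : topologicalType) := Chart {
  chart_dom : set M;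
  chart_cod : set E;
  chart_map : chart_dom -> chart_cod;
  chart_inv : chart_cod -> chart_dom;
  chart_dom_open : open chart_dom;
  chart_mapK : cancel chart_map chart_inv;
  chart_invK : cancel chart_inv chart_map;
  chart_map_continuous : continuous chart_map;
  chart_inv_continuous : continuous chart_inv;
  chart_cod_locally_convex : locally_convex_set chart_cod;
  chart_cod_dense_interior : dense_interior chart_cod
}.

Section Charts.
Context {R : realType} {E : lcsType R} {M : topologicalType}.
Implicit Types (phi psi : chart E M).

Definition chart_to phi (x : M) : option E :=
  omap (set_val \o @chart_map _ _ _ phi) (insub x).

Definition chart_from phi (y : E) : option M :=
  omap (set_val \o @chart_inv _ _ _ phi) (insub y).

(* [f \o phi^-1], extended by [0] outside the codomain of [phi] *)
Definition in_chart {F : lcsType R} phi (f : M -> F) : E -> F :=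
  fun y => oapp f 0 (chart_from phi y).

(* [psi \o phi^-1], extended by [0] *)
Definition transition phi psi : E -> E :=
  in_chart phi (fun x => odflt 0 (chart_to psi x)).

Definition transition_dom phi psi : set E :=
  [set y | exists2 x, chart_from phi y = Some x & chart_dom psi x].

Definition smoothly_compatible phi psi : Prop :=
  is_Cr None (transition_dom phi psi) (transition phi psi) /\
  is_Cr None (transition_dom psi phi) (transition psi phi).

(* [n = 0] is allowed: the intersection is then [E]. *)
Definition corner_chart phi : Prop :=
  exists (n : nat) (lambda : 'I_n -> {linear E -> R^o}),
    [/\ forall i, continuous (lambda i),
        forall c : 'I_n -> R,
          (forall x, \sum_(i < n) c i * lambda i x = 0) -> forall i, c i = 0 &
        exists2 O : set E, open O &
          chart_cod phi = O `&` [set x | forall i, 0 <= lambda i x]].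

End Charts.

(* [atlas] need not be maximal; see [charts]. *)
Record manifold {R : realType} (E : lcsType R) := Manifold {
  manifold_space :> topologicalType;
  manifold_hausdorff : hausdorff_space manifold_space;
  atlas : set (chart E manifold_space);
  atlas_cover : forall x, exists2 phi, atlas phi & chart_dom phi x;
  atlas_compatible : forall phi psi, atlas phi -> atlas psi ->
    smoothly_compatible phi psi
}.

(* The charts of a manifold are those of its maximal smooth atlas. *)
Definition charts {R : realType} {E : lcsType R} (M : manifold E) :
    set (chart E M) :=
  [set phi | forall psi, atlas psi -> smoothly_compatible phi psi].

Definition with_corners {R : realType} {E : lcsType R} (M : manifold E) : Prop :=
  forall phi : chart E M, atlas phi -> corner_chart phi.

Definition is_Cr_map {R : realType} {E : lcsType R} {M : manifold E}
    {F : lcsType R} (r : option nat) (f : M -> F) : Prop :=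
  forall phi : chart E M, charts phi -> is_Cr r (chart_cod phi) (in_chart phi f).

(* [f \o (phi^-1 * psi^-1)], extended by [0] *)
Definition in_charts {R : realType} {E1 E2 F : lcsType R}
    {M1 M2 : topologicalType} (phi : chart E1 M1) (psi : chart E2 M2)
    (f : M1 * M2 -> F) : E1 * E2 -> F :=
  fun y => if chart_from phi y.1 is Some x1 then
             if chart_from psi y.2 is Some x2 then f (x1, x2) else 0
           else 0.

Definition is_Crs_map {R : realType} {E1 E2 : lcsType R}
    {M1 : manifold E1} {M2 : manifold E2} {F : lcsType R}
    (r s : option nat) (f : M1 * M2 -> F) : Prop :=
  forall (phi : chart E1 M1) (psi : chart E2 M2), charts phi -> charts psi ->
    is_Crs r s (chart_cod phi) (chart_cod psi) (in_charts phi psi f).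

Section TvsLimits.
Context {R : realType} {F : tvsType R} {T : Type} (G : set_system T).
Context {FG : Filter G}.
Implicit Types f g : T -> F.

Lemma tvs_cvgD f g (a b : F) :
  f @ G --> a -> g @ G --> b -> (fun x => f x + g x) @ G --> a + b.
Proof.
move=> fa gb.
apply: (@cvg_comp _ _ _ (fun x => (f x, g x)) (fun p : F * F => p.1 + p.2)).
  exact: (cvg_pair fa gb).
exact: (@add_continuous F (a, b)).
Qed.

Lemma tvs_cvgZ (c : T -> R) f (k : R) (a : F) :
  c @ G --> k -> f @ G --> a -> (fun x => c x *: f x) @ G --> k *: a.
Proof.
move=> ck fa.
apply: (@cvg_comp _ _ _ (fun x => (c x, f x) : R^o * F) (fun p => p.1 *: p.2)).
  exact: (cvg_pair ck fa).
exact: (@scale_continuous R F (k, a)).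
Qed.

End TvsLimits.

Section DirectionalDerivativesTheory.
Context {R : realType} {E : tvsType R} {F : lcsType R}.
Implicit Types (f g : E -> F) (h x : E) (U : set E) (hs : seq E).

Lemma dderiveE f h x l : is_dderive f h x l -> dderive f h x = l.
Proof.
move=> fl; apply: xget_unique => //= m fm.
exact: (cvg_unique (@is_hausdorff R F) fm fl).
Qed.

Lemma dderive_is f h x : dderivable f h x -> is_dderive f h x (dderive f h x).
Proof. by case=> l fl; rewrite (dderiveE fl). Qed.

Lemma is_dderive_lin c f g h x l m : is_dderive f h x l -> is_dderive g h x m ->
  is_dderive (c *: f + g) h x (c *: l + m).
Proof.
move=> fl gm; rewrite /is_dderive.
have -> : (fun t : R => t^-1 *: ((c *: f + g) (x + t *: h) - (c *: f + g) x)) =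
    fun t => c *: (t^-1 *: (f (x + t *: h) - f x)) +
             t^-1 *: (g (x + t *: h) - g x).
  apply/funext => t; rewrite scalerA mulrC -scalerA -scalerDr; congr (_ *: _).
  by rewrite scalerBr !fctE opprD addrACA.
exact: tvs_cvgD (tvs_cvgZ (cvg_cst c) fl) gm.
Qed.

Lemma is_dderive_local U f g h x l : open U -> U x ->
    (forall y, U y -> f y = g y) ->
  is_dderive f h x l -> is_dderive g h x l.
Proof.
move=> oU Ux fg; rewrite /is_dderive; apply: cvg_trans; apply: near_eq_cvg => /=.
have : (fun t : R => x + t *: h) @ 0 --> x + 0 *: h.
  exact: tvs_cvgD (cvg_cst _) (tvs_cvgZ cvg_id (cvg_cst _)).
rewrite scale0r addr0 => /(_ U (open_nbhs_nbhs (conj oU Ux))) xU.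
have {}xU : \forall t \near (0:R), U (x + t *: h) by exact: xU.
have x0U : within (fun t : R => t != 0) (nbhs (0 : R)) [set t | U (x + t *: h)].
  by rewrite /within /=; near=> t => _; near: t; exact: xU.
by near=> t; rewrite !fg//; near: t; exact: x0U.
Unshelve. all: by end_near. Qed.

Lemma iter_dderive_local U f g hs : open U -> (forall x, U x -> f x = g x) ->
  iter_dderivable U f hs ->
  iter_dderivable U g hs /\
  (forall x, U x -> iter_dderive f hs x = iter_dderive g hs x).
Proof.
move=> oU; elim: hs f g => [//|h hs IH] f g fg /= [df dfs].
have dg x : U x -> is_dderive g h x (dderive f h x).
  by move=> Ux; apply: (is_dderive_local oU Ux fg); apply: dderive_is; exact: df.
have fg' x : U x -> dderive f h x = dderive g h x.
  by move=> Ux; rewrite (dderiveE (dg _ Ux)).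
have [dgs e] := IH _ _ fg' dfs.
split=> //; split=> // x Ux; by exists (dderive f h x); exact: dg.
Qed.

Lemma iter_dderive_lin U c f g hs : open U ->
  iter_dderivable U f hs -> iter_dderivable U g hs ->
  iter_dderivable U (c *: f + g) hs /\
  (forall x, U x -> iter_dderive (c *: f + g) hs x =
                    c *: iter_dderive f hs x + iter_dderive g hs x).
Proof.
move=> oU; elim: hs f g => [//|h hs IH] f g /= [df dfs] [dg dgs].
have dfg x : U x ->
    is_dderive (c *: f + g) h x ((c *: dderive f h + dderive g h) x).
  by move=> Ux; apply: is_dderive_lin; apply: dderive_is; [exact: df|exact: dg].
have [d1 e1] := IH _ _ dfs dgs.
have fg' x : U x ->
    (c *: dderive f h + dderive g h) x = dderive (c *: f + g) h x.
  by move=> Ux; rewrite (dderiveE (dfg _ Ux)).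
have [d2 e2] := iter_dderive_local oU fg' d1.
split; first by split=> // x Ux; eexists; exact: dfg.
by move=> x Ux; rewrite -e2// e1.
Qed.

Lemma iter_dderive0 U hs :
  iter_dderivable U (0 : E -> F) hs /\ iter_dderive (0 : E -> F) hs = 0.
Proof.
have d0 h x : is_dderive (0 : E -> F) h x 0.
  rewrite /is_dderive.
  have -> : (fun t : R => t^-1 *: ((0 : E -> F) (x + t *: h) - (0 : E -> F) x))
      = cst 0 by apply/funext => t; rewrite subr0 scaler0.
  exact: cvg_cst.
elim: hs => [//|h hs [IH1 IH2]] /=.
have -> : dderive (0 : E -> F) h = 0.
  by apply/funext => x; rewrite (dderiveE (d0 h x)).
by split=> //; split=> // x _; exists 0.
Qed.

End DirectionalDerivativesTheory.

Section ContinuousExtensionTheory.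
Context {R : realType} {X : topologicalType} {F : lcsType R} {D : set X}.
Hypothesis dD : dense D.
Implicit Types g : X -> F.

Lemma cextension_unique g0 g g' :
  is_cextension D g0 g -> is_cextension D g0 g' -> g = g'.
Proof.
move=> [cg eg] [cg' eg']; apply/funext => x.
apply: (@is_hausdorff R F) => A B gA gB.
have [||y [ABy Dy]] := dD (O := (g @^-1` A `&` g' @^-1` B)°).
- by exists x; apply: filterI; [exact: (cg x)|exact: (cg' x)].
- exact: open_interior.
have [Ay By] := interior_subset ABy.
exists (g y); split=> //; rewrite eg ?inE// -eg' ?inE//.
Qed.

Lemma cextensionE g0 g : is_cextension D g0 g -> cextension D g0 = g.
Proof. by move=> gg; apply: xget_unique => // g' /cextension_unique; apply. Qed.

End ContinuousExtensionTheory.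

Section TvsNbhs.
Context {R : realType} {F : tvsType R}.
Implicit Types (U : set F) (a : F).

Lemma tvs_nbhsD U : nbhs 0 U ->
  exists2 A : set F, nbhs 0 A & forall a b, A a -> A b -> U (a + b).
Proof.
move=> U0; have /= := @add_continuous F (0, 0) U; rewrite addr0 => /(_ U0).
move=> [[A B] /= [A0 B0] AB]; exists (A `&` B); first exact: filterI.
by move=> a b [Aa _] [_ Bb]; exact: (AB (a, b)).
Qed.

Lemma tvs_nbhsB U : nbhs 0 U ->
  exists2 A : set F, nbhs 0 A & forall a b, A a -> A b -> U (a - b).
Proof.
move=> U0; have /= := @sub_continuous F (0, 0) U; rewrite subr0 => /(_ U0).
move=> [[A B] /= [A0 B0] AB]; exists (A `&` B); first exact: filterI.
by move=> a b [Aa _] [_ Bb]; exact: (AB (a, b)).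
Qed.

Lemma tvs_nbhs_shift U a : nbhs 0 U -> nbhs a [set b | U (b - a)].
Proof.
move=> U0; have : (fun b => b - a) @ a --> a - a.
  exact: tvs_cvgD cvg_id (cvg_cst _).
by rewrite subrr => /(_ _ U0).
Qed.

Lemma tvs_nbhs_add U a : nbhs a U ->
  exists A B : set F, [/\ nbhs a A, nbhs 0 B &
    forall b c, A b -> B c -> U (b + c)].
Proof.
move=> Ua; have /= := @add_continuous F (a, 0) U; rewrite addr0 => /(_ Ua).
move=> [[A B] /= [Aa B0] AB]; exists A, B; split=> //.
by move=> b c Ab Bc; exact: (AB (b, c)).
Qed.

End TvsNbhs.

Section InitialCompactOpen.
Context {R : realType} {F : lcsType R} {W : preTopologicalLmodType R}.
Context {I : Type} {X : I -> topologicalType} (T : forall i, W -> X i -> F).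
Hypothesis Tlin : forall i c f g x,
  @T i (c *: f + g) x = c *: @T i f x + @T i g x.
Hypothesis Tcont : forall i f, continuous (@T i f).
Hypothesis Ttop : forall (G : set_system W) (f : W), Filter G ->
  G --> f <-> forall i (K : set (X i)) (O : set F), compact K -> open O ->
    @T i f @` K `<=` O -> G [set g | @T i g @` K `<=` O].
Hypothesis Tinj : forall f g, (forall i, @T i f =1 @T i g) -> f = g.

Local Lemma Tnbhs (f : W) i (K : set (X i)) (O : set F) : compact K -> open O ->
  @T i f @` K `<=` O -> nbhs f [set g | @T i g @` K `<=` O].
Proof. by have [+ _] := @Ttop (nbhs f) f _; move=> /(_ cvg_id); apply. Qed.

Local Lemma near_unif i (f : W) (K : set (X i)) (U : set F) :
  compact K -> nbhs 0 U ->
  \forall g \near f, forall x, K x -> U (@T i g x - @T i f x).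
Proof.
move=> cK U0; move/compact_near_coveringP/near_covering_withinP : (cK).
apply=> x Kx.
have [A A0 AU] := tvs_nbhsB U0.
pose O := [set b | A (b - @T i f x)]°.
have Ox : nbhs (@T i f x) O by apply: nbhs_interior; exact: tvs_nbhs_shift.
have [B Bx BO] := @uniform_regular F (@T i f x) _ Ox.
pose C := K `&` @T i f @^-1` closure B.
have cC : compact C.
  apply: compact_closedI => //.
  by apply: preimage_closed; [move=> y _; exact: Tcont|exact: closed_closure].
have fCO : @T i f @` C `<=` O.
  by move=> _ [y [_ By] <-]; exact: BO.
have gCO := Tnbhs cC (@open_interior _ _) fCO.
exists (@T i f @^-1` B, [set g | @T i g @` C `<=` O]); first by split=> //; exact: (@Tcont i f x).
move=> [y g] [/= By gO] Ky.
have Cy : C y by split=> //; exact: subset_closure.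
have -> : @T i g y - @T i f y =
    (@T i g y - @T i f x) - (@T i f y - @T i f x) by rewrite opprB addrA subrK.
apply: AU.
  by have /interior_subset : O (@T i g y) by apply: gO; exists y.
by have /interior_subset : O (@T i f y) by apply: fCO; exists y.
Qed.

Local Lemma cvg_unif (G : set_system W) (f : W) : Filter G ->
  (forall i (K : set (X i)) (U : set F), compact K -> nbhs 0 U ->
    G [set g | forall x, K x -> U (@T i g x - @T i f x)]) ->
  G --> f.
Proof.
move=> FG H; apply/Ttop => i K O cK oO fKO.
have : \forall U \near powerset_filter_from (nbhs (0 : F)),
    K `<=` [set x | forall u, U u -> O (@T i f x + u)].
  move/compact_near_coveringP/near_covering_withinP : (cK).
  apply=> x Kx.
  have /tvs_nbhs_add[A [B [Ax B0 AB]]] : nbhs (@T i f x) O.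
    by apply: open_nbhs_nbhs; split=> //; apply: fKO; exists x.
  exists (@T i f @^-1` A, [set U | U `<=` B]).
    by split; [exact: (@Tcont i f x)|exact: small_set_sub].
  by move=> [y U] [/= Ay UB] Ky u Uu; apply: AB => //; exact: UB.
case=> P [P1 P2 [U PU]] PK; have U0 := P1 _ PU.
apply: filterS (H i K U cK U0) => g gU _ [x Kx <-].
by rewrite -(subrK (@T i f x) (@T i g x)) addrC; apply: (PK _ PU x Kx); exact: gU.
Qed.

Local Lemma T0 i x : @T i 0 x = 0.
Proof. by have := @Tlin i (-1) 0 0 x; rewrite !scaleN1r oppr0 addr0 addNr. Qed.

Local Lemma TD i f g x : @T i (f + g) x = @T i f x + @T i g x.
Proof. by rewrite -[f in LHS]scale1r Tlin scale1r. Qed.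

Local Lemma TZ i c f x : @T i (c *: f) x = c *: @T i f x.
Proof. by rewrite -[c *: f in LHS]addr0 Tlin T0 addr0. Qed.

Lemma initial_add_continuous : continuous (fun p : W * W => p.1 + p.2).
Proof.
move=> [f g]; apply: cvg_unif => i K U cK U0.
have [A A0 AU] := tvs_nbhsD U0.
exists ([set f' | forall x, K x -> A (@T i f' x - @T i f x)],
        [set g' | forall x, K x -> A (@T i g' x - @T i g x)]).
  by split; exact: near_unif.
move=> [f' g'] [/= Hf Hg] x Kx; rewrite !TD opprD addrACA.
by apply: AU; [exact: Hf|exact: Hg].
Qed.

Lemma initial_scale_continuous : continuous (fun z : R^o * W => z.1 *: z.2).
Proof.
move=> [a f]; apply: cvg_unif => i K U cK U0.
have [A A0 AU] := tvs_nbhsD U0.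
have /= := @scale_continuous R F (a, 0) A; rewrite scaler0 => /(_ A0).
move=> [[B C] /= [Ba C0] BC].
have H : \forall b \near (a : R^o), K `<=` [set x | A ((b - a) *: @T i f x)].
  move/compact_near_coveringP/near_covering_withinP : (cK) => ncK.
  apply: (ncK _ (nbhs (a : R^o)) (fun b x => A ((b - a) *: @T i f x))) => x Kx.
  have : (fun p : X i * R^o => (p.2 - a) *: @T i f p.1) @ (x, a) -->
      (a - a) *: @T i f x.
    apply: (@tvs_cvgZ R F _ (nbhs ((x, a) : X i * R^o)) _
      (fun p => p.2 - a) (fun p => @T i f p.1)).
      exact: (@tvs_cvgD R R^o _ _ _ snd _ a (- a) cvg_snd (cvg_cst _)).
    apply: (@cvg_comp _ _ _ fst (@T i f)); first exact: cvg_fst.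
    exact: (@Tcont i f x).
  rewrite subrr scale0r => /(_ _ A0)[B' xB' B'A].
  by exists B' => // p /B'A Ap _.
exists (B `&` [set b | K `<=` [set x | A ((b - a) *: @T i f x)]],
        [set g | forall x, K x -> C (@T i g x - @T i f x)]).
  by split; [exact: filterI|exact: near_unif].
move=> [b g] [/= [Bb Hb] Hg] x Kx; rewrite !TZ.
have -> : b *: @T i g x - a *: @T i f x =
    b *: (@T i g x - @T i f x) + (b - a) *: @T i f x.
  by rewrite scalerBr scalerBl addrA subrK.
by apply: AU; [apply: (BC (b, _)); split=> //; exact: Hg|exact: Hb].
Qed.

Lemma initial_hausdorff : hausdorff_space W.
Proof.
move=> f g fg; apply: Tinj => i x; apply: (@is_hausdorff R F).
move=> A B; rewrite !nbhsE => -[A' [oA' A'x] AA] [B' [oB' B'x] BB].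
have ev (h : W) (O : set F) : open O -> O (@T i h x) ->
    nbhs h [set g | @T i g @` [set x] `<=` O].
  move=> oO Ox; apply: Tnbhs => //.
    exact: compact_set1.
  by move=> _ [_ -> <-].
have [h [/= hA hB]] := fg _ _ (ev f A' oA' A'x) (ev g B' oB' B'x).
by exists (@T i h x); split; [apply: AA; apply: hA|apply: BB; apply: hB]; exists x.
Qed.

Lemma initial_locally_convex : exists2 B : set_system W,
  (forall b, b \in B -> convex_set b) & basis B.
Proof.
exists [set A | open A /\ convex_set (A : set (convex_lmodType W))].
  by move=> b; rewrite inE => -[].
split=> [A []//|f].
have FG : Filter (filter_from
    [set U | (open U /\ convex_set (U : set (convex_lmodType W))) /\ U f] id).
  apply: filter_from_filter.
    exists setT; split=> //; split; first exact: openT.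
    by move=> *; rewrite inE.
  move=> A B [[oA cA] Af] [[oB cB] Bf]; exists (A `&` B) => //.
  split=> //; split; first exact: openI.
  move=> x y l; rewrite !inE => -[Ax Bx] [Ay By]; split.
    by apply: set_mem; apply: cA; apply: mem_set.
  by apply: set_mem; apply: cB; apply: mem_set.
apply: cvg_unif => i K U cK.
have [Bs cBs [oBs bBs]] := @locally_convex R F.
move=> /(bBs 0) [V [BV V0] VU].
have cV := cBs V (mem_set BV); have oV := oBs V BV.
exists [set g | forall x, K x -> V (@T i g x - @T i f x)]; last first.
  by move=> g gV x Kx; apply: VU; exact: gV.
split; last by move=> x Kx; rewrite subrr.
split.
  rewrite (_ : [set g | _] =
      (fun g => g - f) @^-1` [set g | @T i g @` K `<=` V]); last first.
    apply/seteqP; split=> g /=.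
      by move=> H _ [x Kx <-]; rewrite -scaleN1r addrC Tlin scaleN1r addrC; exact: H.
    by move=> H x Kx; apply: H; exists x => //; rewrite -scaleN1r addrC Tlin scaleN1r addrC.
  apply: open_comp.
    move=> g _; apply: (@cvg_comp _ _ _ (fun g => (g, - f)) (fun p : W * W => p.1 + p.2)).
      exact: (cvg_pair cvg_id (cvg_cst _)).
    exact: (@initial_add_continuous (g, - f)).
  rewrite openE => g gV; exact: Tnbhs.
move=> g h l; rewrite !inE => Hg Hh x Kx /=.
have := cV _ _ l (mem_set (Hg x Kx)) (mem_set (Hh x Kx)); rewrite inE.
congr V.
have lE (M : lmodType R) (a b : convex_lmodType M) :
  conv l a b = l%:num *: (a : M) + (1 - l%:num) *: (b : M) by [].
rewrite !lE TD !TZ !scalerBr addrACA -opprD -scalerDl.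
by rewrite (_ : _ + (1 - _) = 1) ?scale1r// addrC subrK.
Qed.

End InitialCompactOpen.

Lemma initial_cvgP (S : choiceType) (Y : topologicalType) (h : S -> Y)
    (G : set_system (initial_topology h)) (f : initial_topology h) :
  Filter G -> G --> f <-> h @ G --> h f.
Proof.
move=> FG; split=> [Gf|Gf].
  by move=> A hfA; apply: Gf; exact: (@initial_continuous _ _ h f).
move=> A [_ [[B oB <-] /= Bf BA]].
by apply: (filterS BA); apply: Gf; exact: open_nbhs_nbhs.
Qed.

(* The initial topology with respect to the maps
   [T i : S -> {compact-open, X i -> F}] *)
Definition initial_co {I : Type} {X : I -> topologicalType}
    {F : topologicalType} {S : choiceType} (T : forall i, S -> X i -> F) : Type :=
  initial_topology
    ((fun f i => T i f) : S -> prod_topology (fun i => {compact-open, X i -> F})).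

HB.instance Definition _ {I : Type} {X : I -> topologicalType}
    {F : topologicalType} {S : choiceType} (T : forall i, S -> X i -> F) :=
  Topological.on (initial_co T).

Lemma initial_co_cvgP {I : Type} {X : I -> topologicalType}
    {F : topologicalType} {S : choiceType} (T : forall i, S -> X i -> F)
    (G : set_system (initial_co T)) (f : initial_co T) : Filter G ->
  G --> f <-> forall i (K : set (X i)) (O : set F), compact K -> open O ->
    T i f @` K `<=` O -> G [set g | T i g @` K `<=` O].
Proof.
move=> FG; rewrite initial_cvgP cvg_sup; split.
  move=> H i; have /(initial_cvgP _ _).1 /compact_open_cvgP := H i.
  by move=> + K O cK oO KO; apply.
move=> H i; apply/initial_cvgP; apply/compact_open_cvgP => K O cK oO KO.
exact: (H i K O).
Qed.

Section CrDomains.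
Context {R : realType}.

Lemma dense_Cr_dom_int {E : lcsType R} (V : set E) k : dense_interior V ->
  dense (Cr_dom_int V k).
Proof.
move=> dV O [[v y] Ovy] oO.
have [[A B] /= [Av By] AB] : nbhs (v, y) O by exact: open_nbhs_nbhs.
have [_ [[A' oA' <-] /= A'v A'A]] := Av.
have [z [Vz A'z]] : V° `&` A' !=set0.
  exact: (dV _ (set_valP v) _ (open_nbhs_nbhs (conj oA' A'v))).
have zV : z \in V by rewrite inE; exact: interior_subset Vz.
exists (exist _ z zV, y); split; last by rewrite /Cr_dom_int /= set_valE.
apply: AB; split; last exact: nbhs_singleton.
by apply: A'A; rewrite /= set_valE.
Qed.

Lemma dense_Crs_dom_int {E1 E2 : lcsType R} (V1 : set E1) (V2 : set E2) i j :
  dense_interior V1 -> dense_interior V2 ->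
  dense (Crs_dom_int V1 V2 i j).
Proof.
move=> dV1 dV2 O [[[v1 v2] y] Ovy] oO.
have [[A B] /= [Av By] AB] : nbhs (v1, v2, y) O by exact: open_nbhs_nbhs.
have [[A1 A2] /= [Av1 Av2] A12] := Av.
have [_ [[A1' oA1' <-] /= A1'v A1'A]] := Av1.
have [_ [[A2' oA2' <-] /= A2'v A2'A]] := Av2.
have [z1 [Vz1 A1'z]] : V1° `&` A1' !=set0.
  exact: (dV1 _ (set_valP v1) _ (open_nbhs_nbhs (conj oA1' A1'v))).
have [z2 [Vz2 A2'z]] : V2° `&` A2' !=set0.
  exact: (dV2 _ (set_valP v2) _ (open_nbhs_nbhs (conj oA2' A2'v))).
have zV1 : z1 \in V1 by rewrite inE; exact: interior_subset Vz1.
have zV2 : z2 \in V2 by rewrite inE; exact: interior_subset Vz2.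
exists (exist _ z1 zV1, exist _ z2 zV2, y); split; last first.
  by rewrite /Crs_dom_int /= !set_valE.
apply: AB; split; last exact: nbhs_singleton.
by apply: A12; split; [apply: A1'A|apply: A2'A]; rewrite /= set_valE.
Qed.

End CrDomains.

Section SetsLinear.
Context {R : realType}.

Lemma lin_continuous {X : topologicalType} {F : lcsType R} c (f g : X -> F) :
  continuous f -> continuous g -> continuous (c *: f + g).
Proof.
by move=> cf cg x; exact: tvs_cvgD (tvs_cvgZ (cvg_cst c) (cf x)) (cg x).
Qed.

Lemma cextension_is {X : topologicalType} {F : lcsType R} (D : set X)
    (g0 : X -> F) :
  (exists g, is_cextension D g0 g) -> is_cextension D g0 (cextension D g0).
Proof. by move=> eg; exact: xgetPex eg. Qed.

Lemma is_cextension_lin {X : topologicalType} {F : lcsType R} (D : set X) c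
    (f0 g0 h0 f g : X -> F) :
  is_cextension D f0 f -> is_cextension D g0 g ->
  (forall x, D x -> h0 x = c *: f0 x + g0 x) ->
  is_cextension D h0 (c *: f + g).
Proof.
move=> [cf ef] [cg eg] eh; split; first exact: lin_continuous.
by move=> x Dx; rewrite eh -?(ef _ Dx) -?(eg _ Dx)//; exact: set_mem.
Qed.

Section Cr.
Context {E F : lcsType R} (r : option nat) (V : set E).
Implicit Types f g : E -> F.

Lemma is_Cr0 : is_Cr r V (0 : E -> F).
Proof.
split; first by move=> x; exact: cvg_cst.
move=> k _; split=> [y|]; first by have [] := @iter_dderive0 R E F V° (Cr_dirs y).
exists (cst 0); split; first by move=> x; exact: cvg_cst.
by move=> p _; rewrite /dk_int; have [_ ->] := @iter_dderive0 R E F V° (Cr_dirs p.2).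
Qed.

Lemma is_Cr_lin c f g : is_Cr r V f -> is_Cr r V g -> is_Cr r V (c *: f + g).
Proof.
move=> [cf df] [cg dg]; split; first exact: lin_continuous.
move=> k kr; have [[df1 [f' ef]] [dg1 [g' eg]]] := (df k kr, dg k kr).
have L y := iter_dderive_lin c (@open_interior _ V) (df1 y) (dg1 y).
split; first by move=> y; have [] := L y.
exists (c *: f' + g'); apply: is_cextension_lin ef eg _ => p Dp.
exact: (L p.2).2.
Qed.

Lemma dk_is f k : is_Cr r V f -> order_le k r ->
  is_cextension (Cr_dom_int V k) (dk_int V f k) (dk V f k).
Proof. by move=> [_ df] kr; have [_ H] := df k kr; exact: cextension_is. Qed.

Lemma dk_lin c f g k : dense_interior V -> is_Cr r V f -> is_Cr r V g ->
  order_le k r ->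
  dk V (c *: f + g) k = c *: dk V f k + dk V g k.
Proof.
move=> dV Cf Cg kr; apply: cextensionE; first exact: dense_Cr_dom_int.
apply: is_cextension_lin (dk_is Cf kr) (dk_is Cg kr) _ => p Dp.
have [[df _] [dg _]] := (Cf.2 k kr, Cg.2 k kr).
exact: (iter_dderive_lin c (@open_interior _ V) (df p.2) (dg p.2)).2.
Qed.

End Cr.
End SetsLinear.

Section ZeroOrder.
Context {R : realType}.

Lemma dk0 {E F : lcsType R} (V : set E) (f : E -> F) r p : dense_interior V ->
  is_Cr r V f -> dk V f 0 p = f (set_val p.1).
Proof.
move=> dV [cf _]; rewrite /dk.
rewrite (@cextensionE _ _ _ _ (dense_Cr_dom_int (k := 0) dV) _
  (fun p : Cr_dom V 0 => f (set_val p.1)))//; split.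
  move=> q; apply: (@cvg_comp _ _ _ fst (f \o set_val)); first exact: cvg_fst.
  by have /subspace_sigL_continuousP := cf; apply.
by move=> q _; rewrite /dk_int /Cr_dirs /image_mem enum_ord0.
Qed.

Lemma chart_fromP {E : lcsType R} {M : topologicalType} (phi : chart E M) x :
  chart_dom phi x -> exists v : chart_cod phi, chart_from phi (set_val v) = Some x.
Proof.
move=> px; pose x' : chart_dom phi := exist _ x (mem_set px).
exists (chart_map x'); rewrite /chart_from /= set_valE.
have -> : insub (\val (chart_map x')) = Some (chart_map x') by exact: valK.
by rewrite /= chart_mapK.
Qed.

Lemma atlas_charts {E : lcsType R} (M : manifold E) (phi : chart E M) :
  atlas phi -> charts phi.
Proof. by move=> Mphi psi; exact: atlas_compatible. Qed.

Lemma in_chart_lin {E F : lcsType R} {M : topologicalType} (phi : chart E M)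
    c (f g : M -> F) :
  in_chart phi (c *: f + g) = c *: in_chart phi f + in_chart phi g.
Proof.
apply/funext => y; rewrite !fctE/= /in_chart; case: chart_from => //=.
by rewrite scaler0 addr0.
Qed.

End ZeroOrder.

Section CrmapDef.
Context {R : realType} {E : lcsType R} (r : option nat) (M : manifold E).
Context (F : lcsType R).

Definition Cr_pred : {pred M -> F} := mem [set f : M -> F | is_Cr_map r f].

(* The space C^r(M, F) *)
Record Crmap := MkCrmap { Crmap_fun :> M -> F; _ : Crmap_fun \in Cr_pred }.

HB.instance Definition _ := [isSub for Crmap_fun].
HB.instance Definition _ := [Choice of Crmap by <:].

Lemma Cr_submod_closed : submod_closed Cr_pred.
Proof.
split=> [|c f g]; rewrite !inE.
  move=> phi _; rewrite (_ : in_chart _ _ = 0); first exact: is_Cr0.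
  by apply/funext => y; rewrite /in_chart; case: chart_from.
move=> Cf Cg phi Mphi; rewrite in_chart_lin.
by apply: is_Cr_lin; [exact: Cf|exact: Cg].
Qed.

HB.instance Definition _ :=
  GRing.isSubmodClosed.Build _ _ Cr_pred Cr_submod_closed.
HB.instance Definition _ := [SubChoice_isSubLmodule of Crmap by <:].

End CrmapDef.

Section CrmapTopology.
Context {R : realType} {E : lcsType R} (r : option nat) (M : manifold E).
Context (F : lcsType R).

Definition Cr_index : set (chart E M * nat) :=
  [set i | charts i.1 /\ order_le i.2 r].

Definition Crmap_dk (i : Cr_index) (f : Crmap r M F) :
    Cr_dom (chart_cod (set_val i).1) (set_val i).2 -> F :=
  dk (chart_cod (set_val i).1) (in_chart (set_val i).1 f) (set_val i).2.

(* By transitivity of initial topologies, this is the initial topology with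
   respect to the maps [f |-> f \o phi^-1] into the spaces C^r(V_phi, F),
   which carry the initial topology with respect to the [d^(k)]. *)
HB.instance Definition _ := Topological.copy (Crmap r M F) (initial_co Crmap_dk).

Lemma Crmap_is_Cr (f : Crmap r M F) (i : Cr_index) :
  is_Cr r (chart_cod (set_val i).1) (in_chart (set_val i).1 f).
Proof.
case: f => f /= /set_mem; apply.
by have [] := set_valP i.
Qed.

Let Tlin (i : Cr_index) c (f g : Crmap r M F) p :
  @Crmap_dk i (c *: f + g) p = c *: @Crmap_dk i f p + @Crmap_dk i g p.
Proof.
rewrite /Crmap_dk in_chart_lin (dk_lin (r := r)) //.
- exact: chart_cod_dense_interior.
- exact: Crmap_is_Cr.
- exact: Crmap_is_Cr.
- by have [] := set_valP i.
Qed.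

Let Tcont (i : Cr_index) (f : Crmap r M F) : continuous (@Crmap_dk i f).
Proof.
have [] // := dk_is (k := (set_val i).2) (Crmap_is_Cr f i).
by have [] := set_valP i.
Qed.

Let Ttop (G : set_system (Crmap r M F)) (f : Crmap r M F) : Filter G ->
  G --> f <-> forall i (K : set (Cr_dom _ _)) (O : set F), compact K -> open O ->
    @Crmap_dk i f @` K `<=` O -> G [set g | @Crmap_dk i g @` K `<=` O].
Proof. exact: (@initial_co_cvgP _ _ _ _ Crmap_dk). Qed.

Let Tinj (f g : Crmap r M F) : (forall i, @Crmap_dk i f =1 @Crmap_dk i g) -> f = g.
Proof.
move=> fg; apply: val_inj; apply/funext => x /=.
have [phi aphi phix] := atlas_cover x.
have [v vx] := chart_fromP phix.
have ip : (phi, 0%N) \in Cr_index.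
  by rewrite inE; split; [exact: atlas_charts|case: (r)].
pose i : Cr_index := @exist _ (fun j => j \in Cr_index) (phi, 0%N) ip.
have dI := @chart_cod_dense_interior _ _ _ phi.
have := fg i (v, fun=> 0); rewrite /Crmap_dk.
rewrite (dk0 _ dI (Crmap_is_Cr f i)) (dk0 _ dI (Crmap_is_Cr g i)) /=.
by rewrite /in_chart /i /= set_valE /= vx.
Qed.

(* This factory only provides the uniform structure. *)
HB.instance Definition _ := @PreTopologicalLmod_isTvs.Build R (Crmap r M F)
  (initial_add_continuous Tlin Tcont Ttop)
  (initial_scale_continuous Tlin Tcont Ttop)
  (initial_locally_convex Tlin Tcont Ttop).
HB.instance Definition _ := PreTopologicalNmodule_isTopologicalNmodule.Build
  (Crmap r M F) (initial_add_continuous Tlin Tcont Ttop).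
HB.instance Definition _ := TopologicalNmodule_isTopologicalLmodule.Build R
  (Crmap r M F) (initial_scale_continuous Tlin Tcont Ttop).
HB.instance Definition _ := Uniform_isTvs.Build R (Crmap r M F)
  (initial_locally_convex Tlin Tcont Ttop).
HB.instance Definition _ := Topological_isHausdorff.Build (Crmap r M F)
  (initial_hausdorff Ttop Tinj).

End CrmapTopology.

Section CrsTheory.
Context {R : realType} {E1 E2 F : lcsType R} (r s : option nat).
Context (V1 : set E1) (V2 : set E2).
Implicit Types f g : E1 * E2 -> F.

Let oV : open (V1° `*` V2°).
Proof.
rewrite openE => -[x y] [/= Vx Vy]; exists (V1°, V2°) => //.
by split; apply: open_nbhs_nbhs; split=> //; exact: open_interior.
Qed.

Lemma is_Crs0 : is_Crs r s V1 V2 (0 : E1 * E2 -> F).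
Proof.
split; first by move=> x; exact: cvg_cst.
move=> i j _ _; split=> [w v|].
  by have [] := @iter_dderive0 R _ F (V1° `*` V2°) (Crs_dirs w v).
exists (cst 0); split; first by move=> x; exact: cvg_cst.
move=> p _; rewrite /dij_int.
by have [_ ->] := @iter_dderive0 R _ F (V1° `*` V2°) (Crs_dirs p.2.1 p.2.2).
Qed.

Lemma is_Crs_lin c f g :
  is_Crs r s V1 V2 f -> is_Crs r s V1 V2 g -> is_Crs r s V1 V2 (c *: f + g).
Proof.
move=> [cf df] [cg dg]; split; first exact: lin_continuous.
move=> i j ir js.
have [[df1 [f' ef]] [dg1 [g' eg]]] := (df i j ir js, dg i j ir js).
have L w v := iter_dderive_lin c oV (df1 w v) (dg1 w v).
split; first by move=> w v; have [] := L w v.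
exists (c *: f' + g'); apply: is_cextension_lin ef eg _ => p [Dp1 Dp2].
by apply: (L p.2.1 p.2.2).2.
Qed.

Lemma dij_is f i j : is_Crs r s V1 V2 f -> order_le i r -> order_le j s ->
  is_cextension (Crs_dom_int V1 V2 i j) (dij_int V1 V2 f i j) (dij V1 V2 f i j).
Proof.
by move=> [_ df] ir js; have [_ H] := df i j ir js; exact: cextension_is.
Qed.

Hypotheses (dV1 : dense_interior V1) (dV2 : dense_interior V2).

Lemma dij_lin c f g i j : is_Crs r s V1 V2 f -> is_Crs r s V1 V2 g ->
  order_le i r -> order_le j s ->
  dij V1 V2 (c *: f + g) i j = c *: dij V1 V2 f i j + dij V1 V2 g i j.
Proof.
move=> Cf Cg ir js; apply: cextensionE; first exact: dense_Crs_dom_int.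
apply: is_cextension_lin (dij_is Cf ir js) (dij_is Cg ir js) _ => p [Dp1 Dp2].
have [[df _] [dg _]] := (Cf.2 i j ir js, Cg.2 i j ir js).
by apply: (iter_dderive_lin c oV (df p.2.1 p.2.2) (dg p.2.1 p.2.2)).2.
Qed.

Lemma dij0 f p : is_Crs r s V1 V2 f ->
  dij V1 V2 f 0 0 p = f (set_val p.1.1, set_val p.1.2).
Proof.
move=> [cf _]; rewrite /dij.
rewrite (@cextensionE _ _ _ _ (dense_Crs_dom_int (i := 0) (j := 0) dV1 dV2) _
  (fun p : Crs_dom V1 V2 0 0 => f (set_val p.1.1, set_val p.1.2)))//; split.
  move=> q.
  have /subspace_sigL_continuousP cf' := cf.
  have c1 : {for q.1, continuous (sigL (V1 `*` V2) f \o @sigT_of_setX _ _ V1 V2)}.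
    apply: continuous_comp; last exact: cf'.
    exact: sigT_of_setX_continuous.
  apply: (@cvg_comp _ _ _ fst (sigL (V1 `*` V2) f \o @sigT_of_setX _ _ V1 V2)).
    exact: cvg_fst.
  exact: c1.
move=> q _; rewrite /dij_int /Crs_dirs /image_mem !enum_ord0 //.
Qed.

End CrsTheory.

Section CrsmapDef.
Context {R : realType} {E1 E2 : lcsType R} (r s : option nat).
Context (M1 : manifold E1) (M2 : manifold E2) (F : lcsType R).

Definition Crs_pred : {pred M1 * M2 -> F} :=
  mem [set f : M1 * M2 -> F | is_Crs_map r s f].

(* The space C^{r,s}(M1 x M2, F) *)
Record Crsmap := MkCrsmap {
  Crsmap_fun :> M1 * M2 -> F; _ : Crsmap_fun \in Crs_pred }.

HB.instance Definition _ := [isSub for Crsmap_fun].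
HB.instance Definition _ := [Choice of Crsmap by <:].

Lemma in_charts_lin (phi : chart E1 M1) (psi : chart E2 M2) c
    (f g : M1 * M2 -> F) :
  in_charts phi psi (c *: f + g) =
  c *: in_charts phi psi f + in_charts phi psi g.
Proof.
apply/funext => y; rewrite !fctE/= /in_charts.
case: (chart_from phi y.1) => [?|]; last by rewrite scaler0 addr0.
by case: (chart_from psi y.2) => [?|] //; rewrite scaler0 addr0.
Qed.

Lemma Crs_submod_closed : submod_closed Crs_pred.
Proof.
split=> [|c f g]; rewrite !inE.
  move=> phi psi _ _; rewrite (_ : in_charts _ _ _ = 0); first exact: is_Crs0.
  apply/funext => y; rewrite /in_charts.
  by case: (chart_from phi y.1) => // ?; case: (chart_from psi y.2).
move=> Cf Cg phi psi Mphi Mpsi; rewrite in_charts_lin.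
by apply: is_Crs_lin; [exact: Cf|exact: Cg].
Qed.

HB.instance Definition _ :=
  GRing.isSubmodClosed.Build _ _ Crs_pred Crs_submod_closed.
HB.instance Definition _ := [SubChoice_isSubLmodule of Crsmap by <:].

End CrsmapDef.

Section CrsmapTopology.
Context {R : realType} {E1 E2 : lcsType R} (r s : option nat).
Context (M1 : manifold E1) (M2 : manifold E2) (F : lcsType R).
Local Notation Crs := (Crsmap r s M1 M2 F).

Definition Crs_index : set ((chart E1 M1 * chart E2 M2) * (nat * nat)) :=
  [set i | (charts i.1.1 /\ charts i.1.2) /\
           (order_le i.2.1 r /\ order_le i.2.2 s)].

Definition Crsmap_dij (i : Crs_index) (f : Crs) :
    Crs_dom (chart_cod (set_val i).1.1) (chart_cod (set_val i).1.2)
      (set_val i).2.1 (set_val i).2.2 -> F :=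
  dij (chart_cod (set_val i).1.1) (chart_cod (set_val i).1.2)
    (in_charts (set_val i).1.1 (set_val i).1.2 f)
    (set_val i).2.1 (set_val i).2.2.

HB.instance Definition _ := Topological.copy Crs (initial_co Crsmap_dij).

Lemma Crsmap_is_Crs (f : Crs) (i : Crs_index) :
  is_Crs r s (chart_cod (set_val i).1.1) (chart_cod (set_val i).1.2)
    (in_charts (set_val i).1.1 (set_val i).1.2 f).
Proof.
by case: f => f /= /set_mem; apply; have [[]] := set_valP i.
Qed.

Let Tlin (i : Crs_index) c (f g : Crs) p :
  @Crsmap_dij i (c *: f + g) p = c *: @Crsmap_dij i f p + @Crsmap_dij i g p.
Proof.
have [_ [ir js]] := set_valP i.
rewrite /Crsmap_dij in_charts_lin (dij_lin (r := r) (s := s)) //;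
  by [exact: chart_cod_dense_interior|exact: Crsmap_is_Crs].
Qed.

Let Tcont (i : Crs_index) (f : Crs) : continuous (@Crsmap_dij i f).
Proof.
have [_ [ir js]] := set_valP i.
by have [] := dij_is (Crsmap_is_Crs f i) ir js.
Qed.

Let Ttop (G : set_system Crs) (f : Crs) : Filter G ->
  G --> f <-> forall i (K : set (Crs_dom _ _ _ _)) (O : set F),
    compact K -> open O ->
    @Crsmap_dij i f @` K `<=` O -> G [set g | @Crsmap_dij i g @` K `<=` O].
Proof. exact: (@initial_co_cvgP _ _ _ _ Crsmap_dij). Qed.

Let Tinj (f g : Crs) : (forall i, @Crsmap_dij i f =1 @Crsmap_dij i g) -> f = g.
Proof.
move=> fg; apply: val_inj; apply/funext => -[x1 x2] /=.
have [phi aphi /chart_fromP[v1 vx1]] := atlas_cover x1.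
have [psi apsi /chart_fromP[v2 vx2]] := atlas_cover x2.
have ip : ((phi, psi), (0%N, 0%N)) \in Crs_index.
  by rewrite inE; do 2?split; [exact: atlas_charts|exact: atlas_charts|case: (r)|case: (s)].
pose i : Crs_index := @exist _ (fun j => j \in Crs_index) _ ip.
have d1 := @chart_cod_dense_interior _ _ _ phi.
have d2 := @chart_cod_dense_interior _ _ _ psi.
have := fg i ((v1, v2), (fun=> 0, fun=> 0)); rewrite /Crsmap_dij.
rewrite (dij0 d1 d2 _ (Crsmap_is_Crs f i)) (dij0 d1 d2 _ (Crsmap_is_Crs g i)) /=.
by rewrite /in_charts /i /= set_valE /= vx1 vx2.
Qed.

HB.instance Definition _ := @PreTopologicalLmod_isTvs.Build R Crs
  (initial_add_continuous Tlin Tcont Ttop)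
  (initial_scale_continuous Tlin Tcont Ttop)
  (initial_locally_convex Tlin Tcont Ttop).
HB.instance Definition _ := PreTopologicalNmodule_isTopologicalNmodule.Build
  Crs (initial_add_continuous Tlin Tcont Ttop).
HB.instance Definition _ := TopologicalNmodule_isTopologicalLmodule.Build R
  Crs (initial_scale_continuous Tlin Tcont Ttop).
HB.instance Definition _ := Uniform_isTvs.Build R Crs
  (initial_locally_convex Tlin Tcont Ttop).
HB.instance Definition _ := Topological_isHausdorff.Build Crs
  (initial_hausdorff Ttop Tinj).

End CrsmapTopology.

(* A metric with values in [R] that induces the topology of [T] *)
Definition metrizable (R : realType) (T : topologicalType) : Prop :=
  exists d : T -> T -> R,
    [/\ forall x y, d x y = 0 <-> x = y,
        forall x y, d x y = d y x,
        forall x y z, d x z <= d x y + d y z &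
        forall x (A : set T),
          nbhs x A <-> exists2 e, 0 < e & [set y | d x y < e] `<=` A].

Definition k_space (T : topologicalType) : Prop :=
  hausdorff_space T /\
  forall A : set T,
    open A <-> forall K : set T, compact K -> open (set_val @^-1` A : set K).

Definition hemicompact (T : topologicalType) : Prop :=
  exists K : nat -> set T,
    [/\ forall n, compact (K n),
        forall n, K n `<=` K n.+1,
        \bigcup_n K n = [set: T] &
        forall C, compact C -> exists n, C `<=` K n].

Definition finite_dimensional {R : realType} (E : lmodType R) : Prop :=
  exists (n : nat) (b : 'I_n -> E),
    forall x, exists c : 'I_n -> R, x = \sum_(i < n) c i *: b i.

Definition tvs_isomorphism {R : realType} {V W : topologicalLmodType R}
    (f : {linear V -> W}) : Prop :=
  continuous f /\
  exists g : W -> V, [/\ cancel f g, cancel g f & continuous g].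

(* Main.v *)
Require Import Defs.
From HB Require Import structures.
From mathcomp Require Import all_boot all_order all_algebra.
From mathcomp Require Import all_classical all_reals all_analysis.
From mathcomp Require Import ring.
Import Order.TTheory GRing.Theory Num.Theory.
Import numFieldNormedType.Exports.

Set Implicit Arguments.
Unset Strict Implicit.
Unset Printing Implicit Defensive.

Local Open Scope classical_set_scope.
Local Open Scope ring_scope.

(** The law rests on one closedness statement: a limit of C^s-maps whose
differentials all converge in the compact-open topology is again C^s, and its
differentials are the limits. [Cr_limit] is this statement on a subset of a
locally convex space, [Crmap_limit] its version on a manifold. It comes from a
mean value theorem for curves in a locally convex space, [mean_value]: a
difference quotient lies in every convex set that is a neighbourhood of all
derivatives along the way. Its proof uses only convexity and the order of the
real line.

Currying. Let [f] be C^{r,s} on a product of two chart codomains [V] and [W].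
For [v] in the interior of [V] the map [f(v, -)] is C^s with differentials
[d^(0,j) f(v, -)]; for boundary points this follows by passing to the limit
([Cr_section]). The difference quotients of [v |-> d^(k,j) f(v, -)] converge in
the compact-open topology, including over the boundary of [W]
([diff_quot_co_cvg]). Hence [Crmap_limit] produces the derivatives of the
curried map one direction at a time and identifies the differential of order
[j] of its differential of order [k] with [d^(k,j) f] ([dk_curry]). The order of
differentiation is never exchanged: smoothness of a derivative in the second
variable is part of what the closedness statement yields.

Uncurrying. Evaluating [d^(j)] at a point is a continuous linear map on
C^s(M2, F), so that it commutes with derivatives in the first variable
([iter_dderive_linear]). The differentials of the uncurried map are therefore
known, and only their joint continuity is at stake. A continuous map from [X]
to the maps from [Y] to [F] gives, after uncurrying, a map that is continuous on
[X * L] for each compact [L]. So it suffices that a set which is relatively open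
in all these [X * L] be a neighbourhood of its points; this is [joint_at]. It
holds if [Y] has compact neighbourhoods ([compact_nbhs_joint]), if [X] and [Y]
are first countable, since a convergent sequence together with its limit is
compact ([first_countable_joint]), and if [X * Y] satisfies a k_omega condition
([komega_joint]), which is stable under finite products ([komega_prod]). These
are the three cases of the theorem. Corners enter because an open part of a
closed subset inherits compact neighbourhoods and the k_omega condition, and
homeomorphisms carry both to all other charts ([corner_chart_at]).

Topologies. The topologies of both function spaces describe uniform convergence
on compact sets of the same functions [d^(i,j) f]: a compact set of the product
lies in the product of its two projections, and conversely. *)

(** * Convexity and the mean value theorem *)

Section MeanValue.
Context {R : realType} {F : lcsType R}.

Definition convex_subset (A : set F) := forall (a b : F) (l : R), 0 <= l -> l <= 1 ->
  A a -> A b -> A (l *: a + (1 - l) *: b).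

(** The form in which local convexity is used: the closure makes it possible to
pass to limits without leaving the given neighbourhood. *)
Lemma lcs_nbhs (a : F) (U : set F) : nbhs a U ->
  exists A : set F, [/\ open A, convex_subset A, A a & closure A `<=` U].
Proof.
move=> Ua; have [B Ba BU] := @uniform_regular F a _ Ua.
have [Bs cBs [oBs bBs]] := @locally_convex R F.
have [A [BA Aa] AB] := bBs a _ Ba.
exists A; split => //; first exact: oBs.
  move=> x y l l0 l1 Ax Ay.
  have l01 : Itv.spec (@Itv.num_sem R)
      (Itv.Real (Interval (BLeft 0%Z) (BRight 1%Z))) l.
    by rewrite /= /Itv.num_sem /= in_itv/= l0 l1 andbT ger0_real.
  have := cBs A (mem_set BA) x y (Itv.Def l01) (mem_set Ax) (mem_set Ay).
  by rewrite inE.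
by apply: subset_trans BU; exact: closure_subset.
Qed.

Definition is_rderive (g : R -> F) (x : R) (l : F) : Prop :=
  (fun h : R => h^-1 *: (g (x + h) - g x)) @ 0^' --> l.

(** The difference quotient over an interval from 0 to [y] is a convex combination
of those over the two parts into which a point [x] divides it. So the set of all
end points for which the quotient lies in [A] extends past each of its points,
contains its supremum, and hence reaches [a]. *)
Lemma mean_value_pos (g g' : R -> F) (a : R) (A : set F) : 0 < a -> convex_subset A ->
    (forall x, 0 <= x <= a -> is_rderive g x (g' x)) ->
    (forall x, 0 <= x <= a -> nbhs (g' x) A) ->
  A (a^-1 *: (g a - g 0)).
Proof.
move=> a0 cA dg Ag.
have loc x : 0 <= x <= a -> exists2 d, 0 < d & forall h, h != 0 -> `|h| < d ->
    A (h^-1 *: (g (x + h) - g x)).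
  move=> xa; have [e /= e0 eA] := dg x xa _ (Ag x xa).
  exists e => // h h0 he; apply: (eA h) => //=.
  by rewrite sub0r normrN.
(* The value 0 is admitted to start the argument; its quotient is meaningless. *)
pose P x := x = 0 \/ A (x^-1 *: (g x - g 0)).
have step x y : P x -> 0 <= x -> x < y -> A ((y - x)^-1 *: (g y - g x)) -> P y.
  move=> [->|Px] x0 xy; first by rewrite subr0; right.
  have y0 : 0 < y by exact: le_lt_trans xy.
  move=> Pxy; right; have := @cA _ _ (x / y) _ _ Px Pxy.
  have -> : x / y *: (x^-1 *: (g x - g 0)) +
      (1 - x / y) *: ((y - x)^-1 *: (g y - g x)) = y^-1 *: (g y - g 0).
    have [->|xN0] := eqVneq x 0.
      by rewrite mul0r scale0r add0r !subr0 scale1r.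
    rewrite !scalerA.
    have -> : x / y / x = y^-1 by rewrite mulrAC divff// mul1r.
    have -> : (1 - x / y) / (y - x) = y^-1.
      by field; rewrite subr_eq0 !gt_eqF.
    by rewrite -scalerDr addrC addrA subrK.
  by apply; rewrite ?divr_ge0 ?(ltW y0)// ler_pdivrMr// mul1r ltW.
pose S := [set x | 0 <= x <= a /\ P x].
have S0 : S 0 by split; [rewrite lexx ltW|left].
have ubS : ubound S a by move=> x [/andP[]].
have supS : has_sup S by split; [exists 0|exists a].
have s0 : 0 <= sup S by apply: ub_le_sup => //; exists a.
have sa : sup S <= a by apply: ge_sup => //; exists 0.
have sin : 0 <= sup S <= a by rewrite s0 sa.
have [d d0 dA] := loc _ sin.
have Ps : P (sup S).
  have [x [/andP[x0 xa] Px] sx] := sup_adherent d0 supS.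
  have xs : x <= sup S.
    by apply: ub_le_sup; [exists a|split=> //; apply/andP; split].
  have [<-//|xNs] := eqVneq x (sup S).
  have {}xs : x < sup S by rewrite lt_neqAle xNs.
  apply: (step x) => //.
  have := dA (x - sup S); rewrite subr_eq0 xNs => /(_ isT).
  rewrite ltr0_norm ?subr_lt0// opprB ltrBlDr addrC -ltrBlDr sx => /(_ isT).
  have -> : sup S + (x - sup S) = x by rewrite addrC subrK.
  by rewrite -(opprB (sup S) x) invrN scaleNr -scalerN opprB.
have [sE|sNa] := eqVneq (sup S) a.
  case: Ps; rewrite sE// => aE; by rewrite aE ltxx in a0.
have {}sa : sup S < a by rewrite lt_neqAle sNa.
pose h := Num.min (a - sup S) (d / 2).
have h0 : 0 < h by rewrite lt_min subr_gt0 sa divr_gt0.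
have : S (sup S + h).
  split.
    by rewrite addr_ge0 ?(ltW h0)//= -lerBrDl ge_min lexx.
  apply: (step (sup S)) => //; first by rewrite ltrDl.
  rewrite addrAC subrr add0r; apply: dA; first by rewrite gt_eqF.
  rewrite gtr0_norm// /h gt_min; apply/orP; right.
  by rewrite ltr_pdivrMr// ltr_pMr// ltrDl ltr01.
move=> /(ub_le_sup (ex_intro _ a ubS)); rewrite gerDl.
by rewrite leNgt h0.
Qed.

Lemma mean_value (g g' : R -> F) (a : R) (A : set F) : a != 0 -> convex_subset A ->
    (forall x, `|x| <= `|a| -> is_rderive g x (g' x)) ->
    (forall x, `|x| <= `|a| -> nbhs (g' x) A) ->
  A (a^-1 *: (g a - g 0)).
Proof.
move=> a0 cA dg Ag; have [ap|an] := ltP 0 a.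
  apply: (@mean_value_pos g g' a A) => // x /andP[x0 xa].
    by apply: dg; rewrite !ger0_norm// ltW.
  by apply: Ag; rewrite !ger0_norm// ltW.
have {}an : a < 0 by rewrite lt_neqAle a0.
pose f x := - g (- x).
have : A ((- a)^-1 *: (f (- a) - f 0)).
  apply: (@mean_value_pos f (fun x => g' (- x))) => //.
  - by rewrite oppr_gt0.
  - move=> x /andP[x0 xa]; rewrite /is_rderive /f.
    have -> : (fun h : R => h^-1 *: (- g (- (x + h)) - - g (- x))) =
        (fun h : R => h^-1 *: (g (- x + h) - g (- x))) \o -%R.
      apply/funext => h /=; rewrite invrN scaleNr -scalerN opprB opprD.
      by rewrite opprK addrC.
    apply: cvg_comp; last first.
      by apply: dg; rewrite normrN ger0_norm// ltr0_norm.
    move=> B [e /= e0 eB]; exists e => //= h; rewrite /= sub0r normrN => he h0.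
    by apply: eB => /=; rewrite ?sub0r ?normrN// oppr_eq0.
  - by move=> x /andP[x0 xa]; apply: Ag; rewrite normrN ger0_norm// ltr0_norm.
by rewrite /f opprK oppr0 invrN scaleNr -scalerN opprB opprK addrC.
Qed.

End MeanValue.

(** * Convergence in the compact-open topology *)

Lemma cvg_pair_at {T : Type} {X Y : topologicalType} (G : set_system T)
    (u : T -> X) (v : T -> Y) (x : X) (y : Y) : Filter G ->
  u @ G --> x -> v @ G --> y -> (fun t => (u t, v t)) @ G --> (x, y).
Proof. by move=> FG ux vy; exact: (cvg_pair ux vy). Qed.

Lemma pairl_cvg {X Y : topologicalType} (y : Y) (x : X) :
  (fun x : X => (x, y)) @ x --> (x, y).
Proof. by apply: cvg_pair_at; [exact: cvg_id|exact: cvg_cst]. Qed.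

Lemma cvg_comp_at {T : Type} {X Y : topologicalType} (G : set_system T)
    (u : T -> X) (g : X -> Y) (x : X) : Filter G ->
  u @ G --> x -> {for x, continuous g} -> (fun t => g (u t)) @ G --> g x.
Proof. by move=> FG ux gx; exact: (cvg_comp _ _ ux gx). Qed.

Section CompactOpen.
Context {X F : topologicalType}.

(** Convergence for the compact-open topology along an arbitrary filter, for a
family of functions rather than points of a function space. *)
Definition co_cvg (T : Type) (G : set_system T) (A : T -> X -> F)
    (h : X -> F) : Prop :=
  forall (K : set X) (O : set F), compact K -> open O ->
    h @` K `<=` O -> G [set t | A t @` K `<=` O].

Lemma co_cvg_comp (S T : Type) (G : set_system S) (u : S -> T)
    (H : set_system T) (A : T -> X -> F) h :
  (forall U, H U -> G (u @^-1` U)) -> co_cvg H A h -> co_cvg G (A \o u) h.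
Proof. by move=> GH Ah K O cK oO KO; exact: GH (Ah K O cK oO KO). Qed.

Lemma co_cvg_eq (T : Type) (G : set_system T) (A B : T -> X -> F) h : Filter G ->
  (\forall t \near G, A t =1 B t) -> co_cvg G A h -> co_cvg G B h.
Proof.
move=> FG AB Ah K O cK oO KO; apply: filterS2 AB (Ah K O cK oO KO).
by move=> t ABt AO _ [x Kx <-]; rewrite -ABt; apply: AO; exists x.
Qed.

Lemma co_cvg_at (T : Type) (G : set_system T) (A : T -> X -> F) h x : Filter G ->
  co_cvg G A h -> (fun t => A t x) @ G --> h x.
Proof.
move=> FG Ah U; rewrite nbhsE => -[B [oB Bhx] BU].
have : G [set t | A t @` [set x] `<=` B].
  by apply: Ah; [exact: compact_set1|exact: oB|move=> _ [_ -> <-]].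
move=> H; apply: (@filterS T G _ _ _ _ H) => t tB; by apply: BU; apply: tB; exists x.
Qed.

(** Compactness turns convergence that is uniform near each single point into
convergence for the compact-open topology. *)
Lemma co_cvg_near (T : Type) (G : set_system T) (A : T -> X -> F) h : Filter G ->
  (forall x O, open O -> O (h x) ->
    \forall x' \near x & t \near G, O (A t x')) ->
  co_cvg G A h.
Proof.
move=> FG H K O cK oO KO.
have /(@compact_near_coveringP X)/(_ T G (fun t x => O (A t x)) FG) := cK.
have KH x : K x -> \forall x' \near x & t \near G, O (A t x').
  by move=> Kx; apply: H => //; apply: KO; exists x.
by move=> /(_ KH); apply: filterS => t KA _ [x /KA Ox <-].
Qed.

End CompactOpen.

Lemma curry_co_cvg {Z X F : topologicalType} (b : Z -> X -> F) (z : Z) :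
  (forall x, (fun p : Z * X => b p.1 p.2) @ (z, x) --> b z x) ->
  co_cvg (nbhs z) b (b z).
Proof.
move=> cb; apply: co_cvg_near => x O oO Ox.
have [[U V] /= [Uz Vx] UV] := cb x O (open_nbhs_nbhs (conj oO Ox)).
by exists (V, U) => // -[x' z'] [/= Vx' Uz']; exact: (UV (z', x')).
Qed.

(** The derivative formula is only available over the dense set [D], which is the
interior when [Y] is the domain of a differential. Near a point of [Y] the mean
value theorem puts the difference quotients over [D] into a convex
neighbourhood of the derivative; by continuity those over [Y] lie in its
closure. *)
Lemma diff_quot_co_cvg {R : realType} {F : lcsType R} {Y : topologicalType}
    (D : set Y) (b b' : R -> Y -> F) (d : R) : dense D -> 0 < d ->
    (forall x, `|x| < d -> continuous (b x)) ->
    (forall x y, `|x| < d -> D y -> is_rderive (b^~ y) x (b' x y)) ->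
    (forall y, (fun p : R * Y => b' p.1 p.2) @ ((0 : R), y) --> b' 0 y) ->
  co_cvg (0 : R)^' (fun t y => t^-1 *: (b t y - b 0 y)) (b' 0).
Proof.
move=> dD d0 cb db cb'; apply: co_cvg_near => y O oO Oy.
have [A [oA cA Ay AO]] := lcs_nbhs (open_nbhs_nbhs (conj oO Oy)).
have [[U V] /= [U0 Vy] UV] := cb' y A (open_nbhs_nbhs (conj oA Ay)).
have [e /= e0 eU] := U0.
exists (V°, [set t : R | t != 0 /\ `|t| < Num.min d e]).
  split => /=; first exact: nbhs_interior.
  exists (Num.min d e) => /=; first by rewrite lt_min d0.
  by move=> t /=; rewrite sub0r normrN => te t0.
move=> [y' t] [/= Vy' [t0]]; rewrite lt_min => /andP[td te]; apply: AO.
move=> B By'.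
have ct : (fun y => t^-1 *: (b t y - b 0 y)) @ y' -->
    t^-1 *: (b t y' - b 0 y').
  apply: tvs_cvgZ; first exact: cvg_cst.
  apply: tvs_cvgD; first exact: cb.
  rewrite -[- b 0 y']scaleN1r.
  have -> : (fun x => - b 0 x) = (fun x => -1 *: b 0 x).
    by apply/funext => x; rewrite scaleN1r.
  by apply: tvs_cvgZ; [exact: cvg_cst|apply: cb; rewrite normr0].
have nB : nbhs y' (((fun y => t^-1 *: (b t y - b 0 y)) @^-1` B `&` V)°).
  by apply: nbhs_interior; apply: filterI; [exact: ct|].
have [||z [Bz Dz]] := dD (((fun y => t^-1 *: (b t y - b 0 y)) @^-1` B `&` V)°).
- by exists y'; exact: nbhs_singleton nB.
- exact: open_interior.
have [/= Bz' Vz] := interior_subset Bz.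
exists (t^-1 *: (b t z - b 0 z)); split => //.
apply: (@mean_value _ _ (b^~ z) (b'^~ z)) => // x xt.
  by apply: db => //; exact: le_lt_trans td.
apply: open_nbhs_nbhs; split=> //; apply: (UV (x, z)); split=> //=.
by apply: eU; rewrite /= sub0r normrN; exact: le_lt_trans te.
Qed.

(** * Iterated directional derivatives *)

Section IterDerive.
Context {R : realType} {E : lmodType R} {F : lcsType R}.
Implicit Types (f : E -> F) (hs : seq E).

Lemma iter_dderive_cat f hs1 hs2 :
  iter_dderive f (hs1 ++ hs2) = iter_dderive (iter_dderive f hs1) hs2.
Proof. by elim: hs1 f => //= h hs IH f; rewrite IH. Qed.

Lemma iter_dderivable_cat U f hs1 hs2 :
  iter_dderivable U f (hs1 ++ hs2) <->
  iter_dderivable U f hs1 /\ iter_dderivable U (iter_dderive f hs1) hs2.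
Proof.
elim: hs1 f => [f|h hs IH f] /=; first by split => [|[]].
by rewrite IH; split=> [[? [? ?]]|[[? ?] ?]].
Qed.

End IterDerive.

Lemma Cr_dirsS {R : realType} {E : lcsType R} k (y : 'I_k.+1 -> E) :
  Cr_dirs y = Cr_dirs (fun i => y (widen_ord (leqnSn k) i)) ++ [:: y ord_max].
Proof.
by rewrite /Cr_dirs /image_mem enum_ordSr map_rcons -cats1 -map_comp.
Qed.

Section ToSet.
Context {E : topologicalType} (V : set E) (v0 : V).

(** A total retraction of the ambient space onto the subtype [V], so that curves
in the space can be followed inside [V]. *)
Definition to_set (x : E) : V := insubd v0 x.

Lemma to_setK x : V x -> set_val (to_set x) = x.
Proof.
by move=> Vx; rewrite set_valE /to_set val_insubd mem_set.
Qed.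

Lemma set_valK (v : V) : to_set (set_val v) = v.
Proof. by rewrite set_valE /to_set valKd. Qed.

Lemma to_set_within x : V x -> to_set @ within V (nbhs x) --> to_set x.
Proof.
move=> Vx U [_ [[B oB <-] /= Bx BU]]; rewrite to_setK// in Bx.
apply: (@filterS _ (nbhs x) _ _ _ _ (open_nbhs_nbhs (conj oB Bx))) => y By Vy.
by apply: BU; rewrite /= to_setK.
Qed.

Lemma to_set_cvg x : V° x -> to_set @ x --> to_set x.
Proof.
move=> Vx U /(to_set_within (interior_subset Vx)) H.
by apply: (@filterS2 _ (nbhs x) _ _ _ _ _ Vx H) => y Vy; exact.
Qed.

End ToSet.

Section Line.
Context {R : realType} {E F : lcsType R}.

Lemma line_cvg (x h : E) (t : R) : (fun t : R => x + t *: h) @ t --> x + t *: h.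
Proof. exact: tvs_cvgD (cvg_cst _) (tvs_cvgZ cvg_id (cvg_cst _)). Qed.

Lemma near_line (V : set E) (x h : E) : V° x ->
  exists2 d : R, 0 < d & forall t, `|t| < d -> V° (x + t *: h).
Proof.
move=> Vx; have := @line_cvg x h 0; rewrite scale0r addr0.
move=> /(_ V° (nbhs_interior Vx)) [d /= d0 dV]; exists d => // t td.
by apply: dV; rewrite /= sub0r normrN.
Qed.

Lemma is_rderive_line (f : E -> F) (x h : E) (t : R) (l : F) :
  is_dderive f h (x + t *: h) l -> is_rderive (fun t => f (x + t *: h)) t l.
Proof.
rewrite /is_dderive /is_rderive.
have -> // : (fun h0 : R => h0^-1 *: (f (x + (t + h0) *: h) - f (x + t *: h))) =
  (fun t0 : R => t0^-1 *: (f (x + t *: h + t0 *: h) - f (x + t *: h))).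
by apply/funext => u; rewrite scalerDl addrA.
Qed.

End Line.

Lemma cvg_in_closure {T : Type} {F : topologicalType} (G : set_system T)
    (u : T -> F) (l : F) (A : set F) : ProperFilter G ->
  u @ G --> l -> G [set t | A (u t)] -> closure A l.
Proof.
move=> PG ul GA B Bl.
have /filter_ex[t [At Bt]] : G [set t | A (u t) /\ B (u t)].
  by apply: filterI => //; exact: ul.
by exists (u t).
Qed.

(** * Closedness of C^s-maps under limits *)

Section CrLimit.
Context {R : realType} {E F : lcsType R} (s : option nat) (W : set E).
Hypothesis dW : dense_interior W.

Lemma order_leW j : order_le j.+1 s -> order_le j s.
Proof. by case: s => //= n; exact: ltnW. Qed.

Lemma dk_int_eq (u : E -> F) j (w : W) (y : 'I_j -> E) : is_Cr s W u ->
    order_le j s -> W° (set_val w) ->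
  dk W u j (w, y) = iter_dderive u (Cr_dirs y) (set_val w).
Proof.
move=> Cu js Ww; have [_ e] := dk_is Cu js.
by rewrite (e (w, y))// inE.
Qed.

(** A differential of order [j+1] is the derivative of the one of order [j] in the
last direction, read along a line. *)
Lemma dk_line (u : E -> F) j (w0 : W) (x : E) (y : 'I_j.+1 -> E) (t : R) :
    is_Cr s W u -> order_le j.+1 s -> W° (x + t *: y ord_max) ->
  is_rderive (fun t => dk W u j (to_set w0 (x + t *: y ord_max),
                                 fun i => y (widen_ord (leqnSn j) i))) t
    (dk W u j.+1 (to_set w0 (x + t *: y ord_max), y)).
Proof.
move=> Cu js Wx; pose y' i := y (widen_ord (leqnSn j) i).
apply: (@is_rderive_line _ _ _ (fun z => dk W u j (to_set w0 z, y'))).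
have WxW : W (x + t *: y ord_max) by exact: interior_subset.
rewrite dk_int_eq// ?to_setK// Cr_dirsS iter_dderive_cat /=.
apply: (@is_dderive_local _ _ _ W° (iter_dderive u (Cr_dirs y'))) => //.
- exact: open_interior.
- move=> z Wz; have ? := interior_subset Wz.
  by rewrite dk_int_eq ?to_setK//; exact: order_leW.
apply: dderive_is.
have [/(_ y) + _] := Cu.2 _ js; rewrite Cr_dirsS.
by move=> /iter_dderivable_cat[_ [+ _]]; exact.
Qed.

(** For the step from [j] to [j+1], take a short segment through an interior point:
it is compact, so eventually all [d^(j+1) (g t)] on it lie in a convex
neighbourhood of [h (j+1)]. By the mean value theorem so do the difference
quotients of [d^(j) (g t)], and those of [h j] lie in its closure. *)
Lemma Cr_limit (T : Type) (G : set_system T) (g : T -> E -> F) (g0 : E -> F)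
    (h : forall j, Cr_dom W j -> F) : ProperFilter G ->
    (\forall t \near G, is_Cr s W (g t)) ->
    (forall j, order_le j s -> continuous (h j)) ->
    (forall j, order_le j s -> co_cvg G (fun t => dk W (g t) j) (h j)) ->
    (forall w : W, g0 (set_val w) = h 0 (w, fun=> 0)) ->
  is_Cr s W g0 /\ forall j, order_le j s -> dk W g0 j = h j.
Proof.
move=> PG Cg ch gh g0E.
have step j (w0 : W) x (y : 'I_j.+1 -> E) : order_le j.+1 s -> W° x ->
    is_dderive (fun x => h j (to_set w0 x, fun i => y (widen_ord (leqnSn j) i)))
      (y ord_max) x (h j.+1 (to_set w0 x, y)).
  move=> js Wx U /lcs_nbhs[A [oA cA Ax AU]].
  pose k := y ord_max.
  have [d d0 dWx] := near_line k Wx.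
  pose q (t : R) : Cr_dom W j.+1 := (to_set w0 (x + t *: k), y).
  have cq (t' : R) : `|t'| < d -> q @ t' --> q t'.
    move=> td; pose u (t : R) := to_set w0 (x + t *: k).
    suff cu : u @ t' --> u t'.
      exact: (@cvg_pair_at _ W {ptws 'I_j.+1 -> E} _ u (fun=> y) _ _ _ cu
        (cvg_cst _)).
    apply: (@cvg_comp _ _ _ (fun t : R => x + t *: k) (to_set w0) (nbhs t')
              (nbhs (x + t' *: k))); first exact: line_cvg.
    exact: to_set_cvg (dWx _ td).
  have q0 : q 0 = (to_set w0 x, y) by rewrite /q scale0r addr0.
  have [e /= e0 eA] : nbhs (0 : R) [set t | A (h j.+1 (q t))].
    have c0 : (h j.+1 \o q) @ (0 : R) --> h j.+1 (q 0).
      apply: (@cvg_comp _ _ _ q (h j.+1) _ (nbhs (q 0))); last exact: (ch _ js).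
      by apply: cq; rewrite normr0.
    by apply: c0; rewrite q0; exact: open_nbhs_nbhs.
  pose m := Num.min d e.
  have m0 : 0 < m by rewrite lt_min d0.
  exists m => //= t; rewrite /= sub0r normrN => tm t0; apply: AU.
  have tde (x' : R) : `|x'| <= `|t| -> `|x'| < d /\ `|x'| < e.
    move=> x't; have := le_lt_trans x't tm.
    by rewrite lt_min => /andP[].
  pose K := q @` [set x' : R | `|x'| <= `|t|].
  have cK : compact K.
    apply: continuous_compact.
      apply: continuous_in_subspaceT => x'; rewrite inE => /= x't.
      exact: cq _ (tde _ x't).1.
    rewrite (_ : [set _ | _] = `[- `|t|, `|t|]%classic).
      exact: segment_compact.
    by apply/seteqP; split=> z /=; rewrite in_itv/= ler_norml.
  have GK : G [set t' | dk W (g t') j.+1 @` K `<=` A].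
    apply: (gh _ js) => // _ [_ [x' x't <-] <-].
    by apply: eA; rewrite /= sub0r normrN; exact: (tde _ x't).2.
  pose y' i := y (widen_ord (leqnSn j) i).
  apply: (cvg_in_closure (G := G) (u := fun t' => t^-1 *:
    (dk W (g t') j (to_set w0 (x + t *: k), y') - dk W (g t') j (to_set w0 x, y')))).
    apply: tvs_cvgZ; first exact: cvg_cst.
    have ghj := gh _ (order_leW js).
    apply: tvs_cvgD; first exact: (co_cvg_at _ ghj).
    rewrite -[- h j _]scaleN1r.
    rewrite (_ : (fun t' => - _) =
        fun t' => -1 *: dk W (g t') j (to_set w0 x, y')); last first.
      by apply/funext => z; rewrite scaleN1r.
    by apply: tvs_cvgZ; [exact: cvg_cst|exact: (co_cvg_at _ ghj)].
  apply: filterS2 Cg GK => t' Ct' At'.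
  have -> : to_set w0 x = to_set w0 (x + 0 *: k) by rewrite scale0r addr0.
  apply: (@mean_value _ _ (fun t => dk W (g t') j (to_set w0 (x + t *: k), y'))
            (fun t => dk W (g t') j.+1 (q t))) => // x' /[dup] x't /tde[x'd x'e].
    by apply: dk_line => //; exact: dWx.
  apply: open_nbhs_nbhs; split=> //; apply: At'; exists (q x') => //.
  by exists x'.
have claim j (y : 'I_j -> E) : order_le j s ->
    iter_dderivable W° g0 (Cr_dirs y) /\
    forall w : W, W° (set_val w) ->
      iter_dderive g0 (Cr_dirs y) (set_val w) = h j (w, y).
  elim: j y => [|j IH] y js.
    rewrite /Cr_dirs /image_mem enum_ord0; split=> // w Ww.
    rewrite /= g0E; congr (h 0 (w, _)).
    by apply/funext => -[].
  rewrite Cr_dirsS.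
  have [d1 e1] := IH (fun i => y (widen_ord (leqnSn j) i)) (order_leW js).
  have dd x : W° x -> forall w0 : W,
      is_dderive (iter_dderive g0 (Cr_dirs (fun i => y (widen_ord (leqnSn j) i))))
        (y ord_max) x (h j.+1 (to_set w0 x, y)).
    move=> Wx w0; 
      apply: (is_dderive_local (@open_interior _ W) Wx _ (step _ _ _ _ js Wx)).
    move=> z Wz; rewrite -e1 to_setK//; exact: interior_subset.
  split.
    apply/iter_dderivable_cat; split => //=; split => // x Wx.
    exists (h j.+1 (to_set (exist _ x (mem_set (interior_subset Wx))) x, y)).
    exact: dd.
  move=> w Ww; rewrite iter_dderive_cat /=.
  by rewrite (dderiveE (dd _ Ww w)) set_valK.
have ext j : order_le j s -> is_cextension (Cr_dom_int W j) (dk_int W g0 j) (h j).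
  move=> js; split; first exact: ch.
  by move=> [w y] /set_mem Ww; rewrite /dk_int /= (claim _ _ js).2.
have js0 : order_le 0 s by case: (s).
split; last by move=> j js; apply: cextensionE (ext j js); exact: dense_Cr_dom_int.
split.
  apply/subspace_sigL_continuousP.
  have -> : sigL W g0 = fun w => h 0 (w, fun=> 0).
    by apply/funext => w; rewrite /sigL /= g0E.
  move=> w; apply: (@cvg_comp _ _ _ (fun w : W => (w, fun=> 0) : Cr_dom W 0) (h 0)).
    pose z : {ptws 'I_0 -> E} := fun=> 0.
    exact: (@cvg_pair_at _ W {ptws 'I_0 -> E} (nbhs w) id (fun=> z) w z _
              cvg_id (cvg_cst z)).
  exact: (ch _ js0).
move=> j js; split; first by move=> y; exact: (claim _ _ js).1.
by exists (h j); exact: ext.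
Qed.

End CrLimit.

(** * Limits of C^s-maps on a manifold *)

Section CrmapLimits.
Context {R : realType} {E F : lcsType R} (s : option nat) (M : manifold E).

Lemma Crmap_in_chart (A : Crmap s M F) (psi : chart E M) : charts psi ->
  is_Cr s (chart_cod psi) (in_chart psi A).
Proof. by case: A => f /= /set_mem; apply. Qed.

Lemma Crmap_cvgP (T : Type) (G : set_system T) (A : T -> Crmap s M F)
    (B : Crmap s M F) : Filter G ->
  A @ G --> B <-> forall psi j, charts psi -> order_le j s ->
    co_cvg G (fun t => dk (chart_cod psi) (in_chart psi (A t)) j)
      (dk (chart_cod psi) (in_chart psi B) j).
Proof.
move=> FG.
have H := @initial_co_cvgP _ _ _ _ (@Crmap_dk R E s M F) (A @ G) B _.
split=> [/H AB psi j Mpsi js|AB].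
  have ip : (psi, j) \in @Cr_index R E s M by rewrite inE.
  exact: (AB (exist _ (psi, j) ip)).
apply/H => i; have [Mi si] := set_valP i.
exact: (AB _ _ Mi si).
Qed.

Lemma chart_from_dom (psi : chart E M) (w : chart_cod psi) :
  chart_from psi (set_val w) = Some (set_val (chart_inv w)).
Proof.
rewrite /chart_from; have -> : insub (set_val w) = Some w by exact: valK.
by [].
Qed.

Lemma Crmap_ext (A B : Crmap s M F) : (forall x, A x = B x) -> A = B.
Proof. by move=> AB; apply: val_inj; apply/funext. Qed.

Lemma in_chart_dk0 (A : Crmap s M F) (psi : chart E M) (w : chart_cod psi) y :
  charts psi ->
  dk (chart_cod psi) (in_chart psi A) 0 (w, y) = in_chart psi A (set_val w).
Proof.
move=> Mpsi; rewrite (dk0 (w, y) _ (Crmap_in_chart A Mpsi))//.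
exact: chart_cod_dense_interior.
Qed.

(** The limit is defined pointwise on the manifold, which makes its local
representatives agree across charts. *)
Lemma Crmap_limit (T : Type) (G : set_system T) (A : T -> Crmap s M F)
    (h : forall (psi : chart E M) j, Cr_dom (chart_cod psi) j -> F) :
    ProperFilter G ->
    (forall psi j, charts psi -> order_le j s -> continuous (h psi j)) ->
    (forall psi j, charts psi -> order_le j s ->
      co_cvg G (fun t => dk (chart_cod psi) (in_chart psi (A t)) j) (h psi j)) ->
  exists2 B : Crmap s M F, A @ G --> B & forall psi j, charts psi ->
    order_le j s -> dk (chart_cod psi) (in_chart psi B) j = h psi j.
Proof.
move=> PG ch Ah.
have s0 : order_le 0 s by case: (s).
have lim psi (w : chart_cod psi) x : charts psi ->
    chart_from psi (set_val w) = Some x ->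
    (fun t => A t x) @ G --> h psi 0 (w, fun=> 0).
  move=> Mpsi wx.
  have -> : (fun t => A t x) =
      fun t => dk (chart_cod psi) (in_chart psi (A t)) 0 (w, fun=> 0).
    by apply/funext => t; rewrite in_chart_dk0// /in_chart wx.
  exact: (co_cvg_at _ (Ah psi 0%N Mpsi s0)).
pose b (x : M) : F := xget 0 [set l | (fun t => A t x) @ G --> l].
have bE psi (w : chart_cod psi) x : charts psi ->
    chart_from psi (set_val w) = Some x -> b x = h psi 0 (w, fun=> 0).
  move=> Mpsi wx; apply: xget_unique; first exact: lim wx.
  move=> l /= Al; apply: (cvg_unique (@is_hausdorff R F) Al); exact: lim wx.
have Cb psi : charts psi -> is_Cr s (chart_cod psi) (in_chart psi b) /\
    forall j, order_le j s -> dk (chart_cod psi) (in_chart psi b) j = h psi j.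
  move=> Mpsi.
  apply: (@Cr_limit _ _ _ s (chart_cod psi) _ T G (fun t => in_chart psi (A t))).
  - exact: chart_cod_dense_interior.
  - by apply: nearW => t; exact: Crmap_in_chart.
  - by move=> j js; exact: ch.
  - by move=> j js; exact: Ah.
  - move=> w; rewrite /in_chart chart_from_dom /=.
    by apply: bE => //; exact: chart_from_dom.
have Cbm : b \in @Cr_pred R E s M F by rewrite inE => psi /Cb[].
exists (MkCrmap Cbm); last by move=> psi j /Cb[_]; exact.
apply/Crmap_cvgP => psi j Mpsi js /=.
by rewrite (Cb psi Mpsi).2//; exact: Ah.
Qed.

Lemma Crmap_dk_inj (A B : Crmap s M F) :
  (forall psi (w : chart_cod psi), charts psi ->
    dk (chart_cod psi) (in_chart psi A) 0 (w, fun=> 0) =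
    dk (chart_cod psi) (in_chart psi B) 0 (w, fun=> 0)) -> A = B.
Proof.
move=> AB; apply: Crmap_ext => x.
have [psi apsi /chart_fromP[w wx]] := atlas_cover x.
have Mpsi := atlas_charts apsi.
by have := AB psi w Mpsi; rewrite !in_chart_dk0// /in_chart wx.
Qed.

Lemma Crmap_dkZB (A B : Crmap s M F) (c : R) psi j p : charts psi ->
  order_le j s -> dk (chart_cod psi) (in_chart psi (c *: (A - B))) j p =
  c *: (dk (chart_cod psi) (in_chart psi A) j p -
        dk (chart_cod psi) (in_chart psi B) j p).
Proof.
move=> Mpsi js.
have dI := @chart_cod_dense_interior _ _ _ psi.
have lin c' (A' B' : Crmap s M F) :
    dk (chart_cod psi) (in_chart psi (c' *: A' + B')) j p =
    c' *: dk (chart_cod psi) (in_chart psi A') j p +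
    dk (chart_cod psi) (in_chart psi B') j p.
  rewrite (_ : in_chart psi _ = c' *: in_chart psi A' + in_chart psi B').
    by rewrite (dk_lin c' dI (Crmap_in_chart A' Mpsi) (Crmap_in_chart B' Mpsi)).
  exact: in_chart_lin.
have -> : c *: (A - B) = c *: ((-1) *: B + A) + 0.
  by rewrite addr0 scaleN1r addrC.
rewrite !lin scaleN1r.
have /= := lin (-1) 0 0; rewrite scaleN1r oppr0 addr0 => ->.
by rewrite scaleN1r addNr addr0 addrC.
Qed.

Lemma Crmap_dk_continuous (A : Crmap s M F) psi j : charts psi -> order_le j s ->
  continuous (dk (chart_cod psi) (in_chart psi A) j).
Proof.
by move=> Mpsi js; have [] := dk_is (Crmap_in_chart A Mpsi) js.
Qed.

End CrmapLimits.

(** * Derivatives along the factors of a product *)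

Section ProductDirections.
Context {R : realType} {E1 E2 F : lcsType R}.
Implicit Types (f : E1 * E2 -> F) (x : E1) (y : E2).

Lemma is_dderive_fst f (h : E1) x y l :
  is_dderive f (h, 0) (x, y) l <-> is_dderive (fun x => f (x, y)) h x l.
Proof.
rewrite /is_dderive.
have -> // : (fun t : R => t^-1 *: (f ((x, y) + t *: (h, 0)) - f (x, y))) =
  (fun t : R => t^-1 *: (f (x + t *: h, y) - f (x, y))).
apply/funext => t; congr (_ *: (f _ - _)).
by apply: injective_projections => //=; rewrite scaler0 addr0.
Qed.

Lemma is_dderive_snd f (h : E2) x y l :
  is_dderive f (0, h) (x, y) l <-> is_dderive (fun y => f (x, y)) h y l.
Proof.
rewrite /is_dderive.
have -> // : (fun t : R => t^-1 *: (f ((x, y) + t *: (0, h)) - f (x, y))) =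
  (fun t : R => t^-1 *: (f (x, y + t *: h) - f (x, y))).
apply/funext => t; congr (_ *: (f _ - _)).
by apply: injective_projections => //=; rewrite scaler0 addr0.
Qed.

Lemma dderive_fst f (h : E1) x y :
  dderive f (h, 0) (x, y) = dderive (fun x => f (x, y)) h x.
Proof.
congr (xget 0 _); apply/seteqP; split=> l /=; by rewrite is_dderive_fst.
Qed.

Lemma dderive_snd f (h : E2) x y :
  dderive f (0, h) (x, y) = dderive (fun y => f (x, y)) h y.
Proof.
congr (xget 0 _); apply/seteqP; split=> l /=; by rewrite is_dderive_snd.
Qed.

(** This holds at every point, whether or not the derivatives exist there, because
the difference quotients are literally the same. *)
Lemma iter_dderive_fst f (hs : seq E1) x y :
  iter_dderive f [seq (h, 0) | h <- hs] (x, y) =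
  iter_dderive (fun x => f (x, y)) hs x.
Proof.
elim: hs f => //= h hs IH f; rewrite IH; congr (iter_dderive _ hs x).
by apply/funext => z; rewrite dderive_fst.
Qed.

Lemma iter_dderive_snd f (hs : seq E2) x y :
  iter_dderive f [seq (0, h) | h <- hs] (x, y) =
  iter_dderive (fun y => f (x, y)) hs y.
Proof.
elim: hs f => //= h hs IH f; rewrite IH; congr (iter_dderive _ hs y).
by apply/funext => z; rewrite dderive_snd.
Qed.

Lemma iter_dderivable_fst (U : set E1) (V : set E2) f (hs : seq E1) :
  iter_dderivable (U `*` V) f [seq (h, 0) | h <- hs] <->
  forall y, V y -> iter_dderivable U (fun x => f (x, y)) hs.
Proof.
elim: hs f => //= h hs IH f; rewrite IH; split.
  move=> [df dfs] y Vy; split.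
    by move=> x Ux; have [l /is_dderive_fst fl] := df (x, y) (conj Ux Vy); exists l.
  rewrite (_ : dderive _ h = fun x => dderive f (h, 0) (x, y)); first exact: dfs.
  by apply/funext => x; rewrite dderive_fst.
move=> H; split.
  move=> [x y] [/= Ux Vy]; have [/(_ x Ux)[l fl] _] := H y Vy.
  by exists l; exact/is_dderive_fst.
move=> y Vy; have [_] := H y Vy.
rewrite (_ : dderive _ h = fun x => dderive f (h, 0) (x, y))//.
by apply/funext => x; rewrite dderive_fst.
Qed.

Lemma iter_dderivable_snd (U : set E1) (V : set E2) f (hs : seq E2) :
  iter_dderivable (U `*` V) f [seq (0, h) | h <- hs] <->
  forall x, U x -> iter_dderivable V (fun y => f (x, y)) hs.
Proof.
elim: hs f => //= h hs IH f; rewrite IH; split.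
  move=> [df dfs] x Ux; split.
    by move=> y Vy; have [l /is_dderive_snd fl] := df (x, y) (conj Ux Vy); exists l.
  rewrite (_ : dderive _ h = fun y => dderive f (0, h) (x, y)); first exact: dfs.
  by apply/funext => y; rewrite dderive_snd.
move=> H; split.
  move=> [x y] [/= Ux Vy]; have [/(_ y Vy)[l fl] _] := H x Ux.
  by exists l; exact/is_dderive_snd.
move=> x Ux; have [_] := H x Ux.
rewrite (_ : dderive _ h = fun y => dderive f (0, h) (x, y))//.
by apply/funext => y; rewrite dderive_snd.
Qed.

Lemma Crs_dirsE i j (w : 'I_i -> E1) (v : 'I_j -> E2) :
  Crs_dirs w v = [seq (0, h) | h <- Cr_dirs v] ++ [seq (h, 0) | h <- Cr_dirs w].
Proof. by rewrite /Crs_dirs /Cr_dirs /image_mem -!map_comp. Qed.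

Lemma Crs_dirsS i j (w : 'I_i.+1 -> E1) (v : 'I_j -> E2) :
  Crs_dirs w v =
  Crs_dirs (fun a => w (widen_ord (leqnSn i) a)) v ++ [:: (w ord_max, 0)].
Proof. by rewrite !Crs_dirsE Cr_dirsS map_cat catA. Qed.

End ProductDirections.

(** Allows limits along a dense set, such as the interior of a chart codomain. *)
Lemma within_dense_proper {X : topologicalType} (D : set X) (x : X) :
  dense D -> ProperFilter (within D (nbhs x)).
Proof.
move=> dD; split; last exact: within_filter.
rewrite /within /= => n0.
have [||y [y0 Dy]] := dD [set y | D y -> set0 y]°.
- by exists x; exact: nbhs_singleton (nbhs_interior n0).
- exact: open_interior.
- exact: (interior_subset y0 Dy).
Qed.

Lemma dense_set_int {R : realType} {E : lcsType R} (V : set E) :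
  dense_interior V -> dense [set v : V | V° (set_val v)].
Proof.
move=> dV O [v Ov] oO.
have [_ [[B oB <-] /= Bv BO]] := open_nbhs_nbhs (conj oO Ov).
have [z [Vz Bz]] := dV _ (set_valP v) _ (open_nbhs_nbhs (conj oB Bv)).
exists (exist _ z (mem_set (interior_subset Vz))); split; last first.
  by rewrite /= set_valE.
by apply: BO; rewrite /= set_valE.
Qed.

(** * C^{r,s}-maps on a product of two sets *)

Section CrsSections.
Context {R : realType} {E1 E2 F : lcsType R} (r s : option nat).
Context (V : set E1) (W : set E2) (f : E1 * E2 -> F).
Hypotheses (dV : dense_interior V) (dW : dense_interior W).
Hypothesis Cf : is_Crs r s V W f.

(** The variables of [d^(i,j)] grouped as for iterated differentials: those of the
first factor in [p], those of the second in [q]. *)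
Definition interleave {i j} (p : Cr_dom V i) (q : Cr_dom W j) : Crs_dom V W i j :=
  ((p.1, q.1), (p.2, q.2)).

Lemma interleave_continuous i j :
  continuous (fun z : Cr_dom V i * Cr_dom W j => interleave z.1 z.2).
Proof.
move=> z; have c1 : (fun z : Cr_dom V i * Cr_dom W j => z.1) @ z --> z.1.
  exact: cvg_fst.
have c2 : (fun z : Cr_dom V i * Cr_dom W j => z.2) @ z --> z.2 by exact: cvg_snd.
apply: cvg_pair_at; apply: cvg_pair_at.
- exact: (cvg_comp _ _ c1 (@cvg_fst _ _ _ _ _)).
- exact: (cvg_comp _ _ c2 (@cvg_fst _ _ _ _ _)).
- exact: (cvg_comp _ _ c1 (@cvg_snd _ _ _ _ _)).
- exact: (cvg_comp _ _ c2 (@cvg_snd _ _ _ _ _)).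
Qed.

Lemma dij_interleave_continuous i j : order_le i r -> order_le j s ->
  continuous (fun z : Cr_dom V i * Cr_dom W j => dij V W f i j (interleave z.1 z.2)).
Proof.
move=> ir js z; have [c _] := dij_is Cf ir js.
by apply: (cvg_comp _ _ (@interleave_continuous i j z)); exact: c.
Qed.

Lemma dij_interleave_continuousr i j (p : Cr_dom V i) :
  order_le i r -> order_le j s ->
  continuous (fun q : Cr_dom W j => dij V W f i j (interleave p q)).
Proof.
move=> ir js q.
have c : (fun q : Cr_dom W j => (p, q)) @ q --> (p, q).
  by apply: cvg_pair_at; [exact: cvg_cst|exact: cvg_id].
exact: (@cvg_comp_at _ _ _ _ _
  (fun z : Cr_dom V i * Cr_dom W j => dij V W f i j (interleave z.1 z.2)) _ _ c
  (@dij_interleave_continuous i j ir js (p, q))).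
Qed.

Lemma dij_curry i j (p : Cr_dom V i) : order_le i r -> order_le j s ->
  co_cvg (nbhs p) (fun p (q : Cr_dom W j) => dij V W f i j (interleave p q))
    (fun q => dij V W f i j (interleave p q)).
Proof.
move=> ir js; apply: curry_co_cvg => q.
exact: (@dij_interleave_continuous i j ir js (p, q)).
Qed.

Lemma dij_int_eq i j (v : V) (y : W) (w : 'I_i -> E1) (u : 'I_j -> E2) :
    order_le i r -> order_le j s -> V° (set_val v) -> W° (set_val y) ->
  dij V W f i j ((v, y), (w, u)) =
  iter_dderive f (Crs_dirs w u) (set_val v, set_val y).
Proof.
move=> ir js Vv Wy; have [_ e] := dij_is Cf ir js.
by rewrite (e ((v, y), (w, u)))// inE.
Qed.

Let r0 : order_le 0 r. Proof. by case: (r). Qed.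
Let s0 : order_le 0 s. Proof. by case: (s). Qed.

(** Over the interior of [V] the differentials are those of [f] in the second
variable; a boundary point is a limit of interior points, and joint continuity
of the extended differentials gives compact-open convergence. *)
Lemma Cr_section (v : V) (z : {ptws 'I_0 -> E1}) :
  is_Cr s W (fun y => f (set_val v, y)) /\
  forall j, order_le j s -> dk W (fun y => f (set_val v, y)) j =
    fun q => dij V W f 0 j (interleave (v, z) q).
Proof.
have int (v' : V) : V° (set_val v') -> is_Cr s W (fun y => f (set_val v', y)) /\
    forall j, order_le j s -> dk W (fun y => f (set_val v', y)) j =
      fun q => dij V W f 0 j (interleave (v', z) q).
  move=> Vv.
  have ext j : order_le j s -> is_cextension (Cr_dom_int W j)
      (dk_int W (fun y => f (set_val v', y)) j)
      (fun q => dij V W f 0 j (interleave (v', z) q)).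
    move=> js; split; first exact: dij_interleave_continuousr.
    move=> [y u] /set_mem Wy; rewrite /interleave dij_int_eq// Crs_dirsE.
    by rewrite /Cr_dirs /image_mem enum_ord0 /= cats0 iter_dderive_snd.
  split; last first.
    by move=> j js; apply: cextensionE (ext j js); exact: dense_Cr_dom_int.
  split.
    apply/subspace_sigL_continuousP.
    pose z2 : {ptws 'I_0 -> E2} := fun=> 0.
    have -> : sigL W (fun y => f (set_val v', y)) =
        fun y => dij V W f 0 0 (interleave (v', z) (y, z2)).
      apply/funext => y.
      by have := dij0 dV dW (interleave (v', z) (y, z2)) Cf => ->.
    move=> y; have c := @pairl_cvg W {ptws 'I_0 -> E2} z2 y.
    exact: (@cvg_comp_at _ (Cr_dom W 0) F (nbhs y) (fun y : W => (y, z2))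
      (fun q : Cr_dom W 0 => dij V W f 0 0 (interleave (v', z) q)) (y, z2) _ c
      (@dij_interleave_continuousr 0 0 (v', z) r0 s0 (y, z2))).
  move=> j js; split; last by eexists; exact: ext.
  move=> u; have [/(_ (fun=> 0) u) + _] := Cf.2 0%N j r0 js.
  rewrite Crs_dirsE => /iter_dderivable_cat[+ _].
  by move=> /iter_dderivable_snd; exact.
pose G := within [set v : V | V° (set_val v)] (nbhs v).
have PG : ProperFilter G by apply: within_dense_proper; exact: dense_set_int.
apply: (@Cr_limit _ _ _ s W dW V G (fun v' y => f (set_val v', y))).
- by apply: (@filterE _ (nbhs v)) => v' /int[].
- by move=> j js; exact: dij_interleave_continuousr.
- move=> j js.
  apply: (@co_cvg_eq _ _ _ _ (fun v' q => dij V W f 0 j (interleave (v', z) q))).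
    by apply: (@filterE _ (nbhs v)) => v' /int[_ ->].
  apply: (@co_cvg_comp _ _ _ _ _ (fun v' : V => (v', z)) (nbhs (v, z))
    (fun p (q : Cr_dom W j) => dij V W f 0 j (interleave p q)));
    last exact: dij_curry.
  move=> U; have c := @pairl_cvg V {ptws 'I_0 -> E1} z v.
  move=> nU; have := c _ nU; exact: (@cvg_within _ (nbhs v)).
- by move=> y; rewrite (dij0 dV dW _ Cf).
Qed.

Lemma dij_line i j (v0 : V) (x : E1) (w : 'I_i.+1 -> E1) (q : Cr_dom W j)
    (t : R) : order_le i.+1 r -> order_le j s ->
    V° (x + t *: w ord_max) -> Cr_dom_int W j q ->
  is_rderive (fun t => dij V W f i j (interleave (to_set v0 (x + t *: w ord_max),
      (fun a => w (widen_ord (leqnSn i) a)) : {ptws 'I_i -> E1}) q)) t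
    (dij V W f i.+1 j (interleave (to_set v0 (x + t *: w ord_max),
      w : {ptws 'I_i.+1 -> E1}) q)).
Proof.
case: q => y u ir js Vx Wy; pose w' a := w (widen_ord (leqnSn i) a).
apply: (@is_rderive_line _ _ _
  (fun x => dij V W f i j (interleave (to_set v0 x, w' : {ptws 'I_i -> E1}) (y, u)))).
have VxV := interior_subset Vx.
rewrite /interleave dij_int_eq// ?to_setK//= Crs_dirsS iter_dderive_cat /=.
apply: (@is_dderive_local _ _ _ V°
  (fun x => iter_dderive f (Crs_dirs w' u) (x, set_val y))) => //.
- exact: open_interior.
- move=> z Vz; have ? := interior_subset Vz.
  by rewrite dij_int_eq ?to_setK//; exact: order_leW ir.
apply/is_dderive_fst; apply: dderive_is.
have [/(_ w u) + _] := Cf.2 _ _ ir js; rewrite Crs_dirsS.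
by move=> /iter_dderivable_cat[_ [+ _]]; apply.
Qed.

End CrsSections.

(** * Currying a C^{r,s}-map *)

Section Curry.
Context {R : realType} {E1 E2 F : lcsType R} (r s : option nat).
Context (M1 : manifold E1) (M2 : manifold E2).
Context (f : M1 * M2 -> F).
Hypothesis Cf : is_Crs_map r s f.

Let r0 : order_le 0 r. Proof. by case: (r). Qed.
Let s0 : order_le 0 s. Proof. by case: (s). Qed.

Lemma in_charts_section (phi : chart E1 M1) (psi : chart E2 M2) v x :
  chart_from phi v = Some x ->
  in_chart psi (fun y => f (x, y)) = fun y => in_charts phi psi f (v, y).
Proof.
by move=> vx; apply/funext => y; rewrite /in_chart /in_charts /= vx; case: chart_from.
Qed.

Lemma Crs_section x : (fun y => f (x, y)) \in @Cr_pred R E2 s M2 F.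
Proof.
rewrite inE => psi Mpsi.
have [phi aphi /chart_fromP[v vx]] := atlas_cover x.
have Mphi := atlas_charts aphi.
rewrite (in_charts_section psi vx).
by have [] := Cr_section (@chart_cod_dense_interior _ _ _ phi)
  (@chart_cod_dense_interior _ _ _ psi) (Cf Mphi Mpsi) v (fun=> 0).
Qed.

Definition curry_map (x : M1) : Crmap s M2 F := MkCrmap (Crs_section x).

Context (phi : chart E1 M1).
Hypothesis Mphi : charts phi.
Local Notation V := (chart_cod phi).
Local Notation g := (in_chart phi curry_map).
Let dV : dense_interior V. Proof. exact: chart_cod_dense_interior. Qed.

Lemma in_chart_curry (psi : chart E2 M2) (v : V) :
  in_chart psi (g (set_val v)) = fun y => in_charts phi psi f (set_val v, y).
Proof.
have e := chart_from_dom v.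
have -> : g (set_val v) = curry_map (set_val (chart_inv v)) by rewrite /in_chart e.
by rewrite -(in_charts_section psi e).
Qed.

Lemma dk_curry0 (psi : chart E2 M2) (v : V) (z : {ptws 'I_0 -> E1}) j :
    charts psi -> order_le j s ->
  dk (chart_cod psi) (in_chart psi (g (set_val v))) j =
  fun q => dij V (chart_cod psi) (in_charts phi psi f) 0 j (interleave (v, z) q).
Proof.
move=> Mpsi js; rewrite in_chart_curry.
have dW := @chart_cod_dense_interior _ _ _ psi.
by have [_ ->] := Cr_section dV dW (Cf Mphi Mpsi) v z.
Qed.

(** The induction adds one direction at the end. The difference quotients of the
derivative found so far converge by [diff_quot_co_cvg] in every chart and every
order [j], which is what [Crmap_limit] asks for. *)
Lemma iter_dderive_curry k (w : 'I_k -> E1) : order_le k r ->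
  iter_dderivable V° g (Cr_dirs w) /\
  forall v : V, V° (set_val v) -> forall psi j, charts psi -> order_le j s ->
    dk (chart_cod psi) (in_chart psi (iter_dderive g (Cr_dirs w) (set_val v))) j =
    fun q => dij V (chart_cod psi) (in_charts phi psi f) k j
      (interleave (v, w : {ptws 'I_k -> E1}) q).
Proof.
elim: k w => [|k IH] w kr.
  rewrite /Cr_dirs /image_mem enum_ord0; split=> // v Vv psi j Mpsi js /=.
  exact: dk_curry0.
rewrite Cr_dirsS.
pose w' i := w (widen_ord (leqnSn k) i); pose h := w ord_max.
have [d1 e1] := IH w' (order_leW kr).
pose D := iter_dderive g (Cr_dirs w').
have step (v : V) : V° (set_val v) -> exists2 B : Crmap s M2 F,
    is_dderive D h (set_val v) B & forall psi j, charts psi -> order_le j s ->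
    dk (chart_cod psi) (in_chart psi B) j =
    fun q => dij V (chart_cod psi) (in_charts phi psi f) k.+1 j
               (interleave (v, w : {ptws 'I_k.+1 -> E1}) q).
  move=> Vv; apply: Crmap_limit.
    move=> psi j Mpsi js; exact: (dij_interleave_continuousr (Cf Mphi Mpsi)).
  move=> psi j Mpsi js.
  have dW := @chart_cod_dense_interior _ _ _ psi.
  have CF := Cf Mphi Mpsi.
  have [d d0 dVv] := near_line h Vv.
  pose b (t : R) (q : Cr_dom (chart_cod psi) j) :=
    dij V (chart_cod psi) (in_charts phi psi f) k j
      (interleave (to_set v (set_val v + t *: h), w' : {ptws 'I_k -> E1}) q).
  pose b' (t : R) (q : Cr_dom (chart_cod psi) j) :=
    dij V (chart_cod psi) (in_charts phi psi f) k.+1 j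
      (interleave (to_set v (set_val v + t *: h), w : {ptws 'I_k.+1 -> E1}) q).
  have Q := @diff_quot_co_cvg _ F _ (Cr_dom_int (chart_cod psi) j) b b' d
    (dense_Cr_dom_int dW) d0.
  have v0 : to_set v (set_val v + 0 *: h) = v by rewrite scale0r addr0 set_valK.
  rewrite [X in co_cvg _ _ X](_ : _ = b' 0); last first.
    by apply/funext => q; rewrite /b' v0.
  apply: co_cvg_eq; last apply: Q.
  - exists d => //= t; rewrite /= sub0r normrN => td _ q.
    have dVt := dVv t td.
    have e (t' : R) : `|t'| < d -> b t' q =
        dk (chart_cod psi) (in_chart psi (D (set_val v + t' *: h))) j q.
      move=> t'd; have Vt := dVv t' t'd.
      have K := to_setK v (interior_subset Vt).
      by rewrite -[in RHS]K /D e1 ?K.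
    rewrite Crmap_dkZB// e// e ?normr0//.
    by rewrite scale0r addr0.
  - move=> t td q.
    exact: (dij_interleave_continuousr CF (order_leW kr) js).
  - move=> t q td Dq; exact: (dij_line CF kr js (dVv t td) Dq).
  - move=> q; have [ct _] := dij_is CF kr js.
    pose u (p : R * Cr_dom (chart_cod psi) j) := to_set v (set_val v + p.1 *: h).
    have cu : u @ ((0 : R), q) --> u (0, q).
      apply: (@cvg_comp_at _ _ _ _ (fun p : R * Cr_dom (chart_cod psi) j =>
        set_val v + p.1 *: h) (to_set v)).
        apply: (@cvg_comp_at _ R _ _ fst (fun t : R => set_val v + t *: h)).
          exact: cvg_fst.
        exact: line_cvg.
      by apply: to_set_cvg; apply: dVv; rewrite normr0.
    have cm : (fun p : R * Cr_dom (chart_cod psi) j =>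
        ((u p, w : {ptws 'I_k.+1 -> E1}), p.2)) @ ((0 : R), q) -->
        ((u (0, q), w : {ptws 'I_k.+1 -> E1}), q).
      apply: (@cvg_pair_at _ (Cr_dom V k.+1) (Cr_dom (chart_cod psi) j)).
        exact: (@cvg_pair_at _ V {ptws 'I_k.+1 -> E1} _ u (fun=> w) _ _ _ cu
          (cvg_cst _)).
      exact: cvg_snd.
    exact: (@cvg_comp_at _ _ _ _ _
      (fun z : Cr_dom V k.+1 * Cr_dom (chart_cod psi) j =>
         dij V (chart_cod psi) (in_charts phi psi f) k.+1 j
           (interleave z.1 z.2)) _ _ cm
      (@dij_interleave_continuous _ _ _ _ _ _ _ _ _ CF _ _ kr js _)).
split.
  apply/iter_dderivable_cat; split=> //=; split=> // x Vx.
  have [B DB _] := step (exist _ x (mem_set (interior_subset Vx))) Vx.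
  by exists B.
move=> v Vv psi j Mpsi js; rewrite iter_dderive_cat /=.
by have [B DB <-//] := step v Vv; rewrite (dderiveE DB).
Qed.

(** The value at a boundary point is the limit, in the space of C^s-maps, of the
values at interior points. *)
Lemma curry_extension k : order_le k r ->
  exists2 A : Cr_dom V k -> Crmap s M2 F,
    is_cextension (Cr_dom_int V k) (dk_int V g k) A &
    forall p psi j, charts psi -> order_le j s ->
      dk (chart_cod psi) (in_chart psi (A p)) j =
      fun q => dij V (chart_cod psi) (in_charts phi psi f) k j (interleave p q).
Proof.
move=> kr.
have ex (p : Cr_dom V k) : exists B : Crmap s M2 F,
    forall psi j, charts psi -> order_le j s ->
    dk (chart_cod psi) (in_chart psi B) j =
    fun q => dij V (chart_cod psi) (in_charts phi psi f) k j (interleave p q).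
  pose G := within (Cr_dom_int V k) (nbhs p).
  have PG : ProperFilter G.
    by apply: within_dense_proper; exact: dense_Cr_dom_int.
  have [||B _ HB] := @Crmap_limit _ _ F s M2 _ G (fun p => dk_int V g k p)
    (fun psi j q => dij V (chart_cod psi) (in_charts phi psi f) k j (interleave p q)).
  - move=> psi j Mpsi js; exact: (dij_interleave_continuousr (Cf Mphi Mpsi)).
  - move=> psi j Mpsi js.
    apply: (@co_cvg_eq _ _ _ _
      (fun p q => dij V (chart_cod psi) (in_charts phi psi f) k j (interleave p q))).
      apply: (@filterE _ (nbhs p)) => -[v w] Vv q.
      by rewrite /dk_int (iter_dderive_curry w kr).2.
    apply: (@co_cvg_comp _ _ _ _ _ id (nbhs p)
      (fun p q => dij V (chart_cod psi) (in_charts phi psi f) k j (interleave p q))).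
      by move=> U; exact: (@cvg_within _ (nbhs p)).
    exact: (dij_curry (Cf Mphi Mpsi)).
  - by exists B.
have [A HA] := choice ex.
exists A => //; split.
  move=> p; apply/Crmap_cvgP => psi j Mpsi js.
  rewrite HA//; apply: (@co_cvg_eq _ _ _ _
      (fun p q => dij V (chart_cod psi) (in_charts phi psi f) k j (interleave p q))).
    by apply: nearW => p' q; rewrite HA.
  exact: (dij_curry (Cf Mphi Mpsi)).
move=> [v w] /set_mem Vv; apply: Crmap_dk_inj => psi y Mpsi.
by rewrite HA// /dk_int (iter_dderive_curry w kr).2.
Qed.

Lemma curry_is_Cr : is_Cr r V g.
Proof.
split.
  apply/subspace_sigL_continuousP => v.
  apply: (@Crmap_cvgP R E2 F s M2 V (nbhs v) (fun v' => g (set_val v'))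
    (g (set_val v)) _).2 => psi j Mpsi js.
  pose z : {ptws 'I_0 -> E1} := fun=> 0.
  rewrite (dk_curry0 v z Mpsi js).
  apply: (@co_cvg_eq _ _ _ _ (fun v' q =>
    dij V (chart_cod psi) (in_charts phi psi f) 0 j (interleave (v', z) q))).
    by apply: nearW => v' q; rewrite (dk_curry0 v' z Mpsi js).
  apply: (@co_cvg_comp _ _ _ _ _ (fun v' : V => (v', z)) (nbhs (v, z))
    (fun p q => dij V _ _ 0 j (interleave p q)));
    last exact: (dij_curry (Cf Mphi Mpsi)).
  by move=> U nU; exact: (@pairl_cvg V {ptws 'I_0 -> E1} z v).
move=> k kr; split; first by move=> w; exact: (iter_dderive_curry w kr).1.
by have [A HA _] := curry_extension kr; exists A.
Qed.

(** The identity by which both topologies are compared. *)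
Lemma dk_curry k j (psi : chart E2 M2) p : order_le k r -> order_le j s ->
    charts psi ->
  dk (chart_cod psi) (in_chart psi (dk V g k p)) j =
  fun q => dij V (chart_cod psi) (in_charts phi psi f) k j (interleave p q).
Proof.
move=> kr js Mpsi; have [A HA eA] := curry_extension kr.
have -> : dk V g k = A by exact: cextensionE (dense_Cr_dom_int dV) _ _ HA.
by rewrite eA.
Qed.

End Curry.

(** * Neighbourhoods of compact sets *)

Lemma nbhs_prodP {X Y : topologicalType} (x : X) (y : Y) (A : set (X * Y)) :
  nbhs (x, y) A <-> exists U V, [/\ nbhs x U, nbhs y V &
    forall u v, U u -> V v -> A (u, v)].
Proof.
split=> [[[U V] /= [Ux Vy] UV]|[U [V [Ux Vy UV]]]].
  by exists U, V; split=> // u v Uu Vv; exact: (UV (u, v)).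
by exists (U, V) => // -[u v] [/= Uu Vv]; exact: UV.
Qed.

(** A family of conditions indexed by points [x] and small sets [H]: if near each
point of a compact set some [H] works, then one [H] works near all of them. *)
Lemma compact_tube {X : topologicalType} {T : Type} (P : set X)
    (G : set_system T) (Q : X -> set T -> Prop) : Filter G -> compact P ->
    (forall x (H H' : set T), H `<=` H' -> Q x H' -> Q x H) ->
    (forall p, P p -> exists2 H, G H & \forall x \near p, Q x H) ->
  exists2 H, G H & forall p, P p -> \forall x \near p, Q x H.
Proof.
move=> FG cP Qanti PQ.
pose G' := filter_from G (fun H => [set H' : set T | H' `<=` H]).
have FG' : Filter G'.
  apply: filter_from_filter; first by exists setT; exact: filterT.
  move=> A B GA GB; exists (A `&` B); first exact: filterI.
  by move=> H HAB; split=> x /HAB[].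
have [] := (compact_near_coveringP P).1 cP _ G' (fun H x => nbhs x (Q^~ H)) FG'.
  move=> p /PQ[H GH pH].
  exists ([set x | nbhs x (Q^~ H)], [set H' | H' `<=` H]).
    by split; [exact: nbhs_interior pH|exists H].
  move=> [x H'] [/= xH H'H]; apply: filterS xH => y; exact: Qanti.
by move=> H GH HP; exists H => // p Pp; exact: (HP H).
Qed.

(** The tube argument is applied to neighbourhoods of the complement of [U], which
yields an open set around that complement that stays away from [P]. *)
Lemma set_nbhs_closed {X : topologicalType} (P U : set X) :
    regular_space X -> compact P -> set_nbhs P U ->
  exists C, [/\ closed C, C `<=` U & set_nbhs P C].
Proof.
move=> rX cP PU.
have [|p Pp|H UH PH] := @compact_tube X X P (set_nbhs (~` U)) (fun x H => ~ H x) _ cP.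
- by move=> x H H' HH' nH' /HH'.
- have [B Bp BU] := rX p U (PU p Pp).
  exists (~` closure B).
    move=> q nUq; apply: open_nbhs_nbhs; split.
      exact/closed_openC/closed_closure.
    by move=> /BU.
  by apply: filterS Bp => x Bx; apply; exact: subset_closure.
exists (~` H°); split.
- exact/open_closedC/open_interior.
- by move=> x; apply: contra_notP => nUx; exact: UH.
- by move=> p /PH; apply: filterS => x nHx /interior_subset.
Qed.

Lemma wallace {X Y : topologicalType} (P : set X) (Q : set Y) (A : set (X * Y)) :
    compact P -> compact Q ->
    (forall p q, P p -> Q q -> nbhs (p, q) A) ->
  exists U V, [/\ set_nbhs P U, set_nbhs Q V &
    forall u v, U u -> V v -> A (u, v)].
Proof.
move=> cP cQ PQA.
have [||V QV PV] := @compact_tube X Y P (set_nbhs Q)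
    (fun u V => forall v, V v -> A (u, v)) _ cP.
- by move=> x H H' HH' Ax v /HH'; exact: Ax.
- move=> p Pp.
  have [||H pH QH] := @compact_tube Y X Q (nbhs p)
      (fun v U => forall u, U u -> A (u, v)) _ cQ.
  + by move=> x H H' HH' Ax v /HH'; exact: Ax.
  + move=> q Qq; have /nbhs_prodP[U [V [Up Vq UV]]] := PQA p q Pp Qq.
    by exists U => //; apply: filterS Vq => v Vv u Uu; exact: UV.
  exists [set v | forall u, H u -> A (u, v)]; first by move=> q /QH.
  by apply: filterS pH => u Hu v; exact.
exists [set u | forall v, V v -> A (u, v)], V; split=> //.
by move=> u v /= uV /uV.
Qed.

(** * Countability and compactness conditions at a point *)

Definition compact_nbhs_at (T : topologicalType) (z : T) : Prop :=
  exists2 K : set T, compact K & nbhs z K.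

Definition first_countable_at (T : topologicalType) (z : T) : Prop :=
  exists B : nat -> set T, (forall n, nbhs z (B n)) /\
    forall U, nbhs z U -> exists n, forall m, (n <= m)%N -> B m `<=` U.

(** The defining condition of a k_omega space, localized at a point so that it
can be transferred from one chart to another. *)
Definition komega_at (T : topologicalType) (z : T) : Prop :=
  exists K : nat -> set T, [/\ forall n, compact (K n),
    forall n, K n `<=` K n.+1, K 0%N z &
    forall A : set T, A z ->
      (forall n p, K n p -> A p -> within (K n) (nbhs p) A) -> nbhs z A].

Lemma ascending_sub {T : Type} (K : nat -> set T) (n m : nat) :
  (forall n, K n `<=` K n.+1) -> (n <= m)%N -> K n `<=` K m.
Proof.
move=> KS /subnK <-; elim: (m - n)%N => [|k IH]; first by rewrite add0n.
by rewrite addSn; apply: subset_trans IH _; exact: KS.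
Qed.

(** The three conditions are carried along a map [j] defined on a set [D] around
[z] whose images of neighbourhoods are neighbourhoods. This covers at once
homeomorphisms, with [D] the whole space, and charts, with [D] a closed subset
of a linear space. *)
Section Transport.
Context {S T : topologicalType} (z : S) (j : S -> T) (D : set S).
Hypothesis Dz : D z.
Hypothesis cj : forall u, D u -> j @ within D (nbhs u) --> j u.
Hypothesis oj : forall A, nbhs z A -> nbhs (j z) (j @` (A `&` D)).

Let cDj (K : set S) : compact K -> closed D -> compact (j @` (K `&` D)).
Proof.
move=> cK cD; apply: continuous_compact; last exact: compact_closedI.
apply: (@continuous_subspaceW _ _ _ D); first exact: subIsetr.
rewrite continuous_subspace_in => u /set_mem Du.
by move=> U jU; have := cj Du jU; rewrite (nbhs_subspace_in Du).
Qed.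

Lemma compact_nbhs_transport : closed D ->
  compact_nbhs_at z -> compact_nbhs_at (j z).
Proof.
move=> cD [K cK Kz]; exists (j @` (K `&` D)); [exact: cDj|exact: oj].
Qed.

Lemma first_countable_transport : first_countable_at z -> first_countable_at (j z).
Proof.
move=> [B [zB Bz]]; exists (fun n => j @` (B n `&` D)); split=> [n|U Uz].
  exact: oj.
have [n nU] := Bz _ (cj Dz Uz); exists n => m nm _ [u [Bu Du] <-].
by apply: (nU m nm).
Qed.

Lemma komega_transport : closed D -> komega_at z -> komega_at (j z).
Proof.
move=> cD [K [cK KS K0 KA]]; exists (fun n => j @` (K n `&` D)); split.
- by move=> n; exact: cDj.
- by move=> n; apply: image_subset; exact: setSI.
- by exists z.
- move=> A Az HA.
  have /oj : nbhs z [set u | D u -> A (j u)].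
    apply: KA => // n p Kp DA.
    have [Dp|nDp] := pselect (D p); last first.
      have : nbhs p (~` D) by apply: open_nbhs_nbhs; split=> //; exact: closed_openC.
      by apply: filterS => u nDu _ /nDu.
    have jKp : (j @` (K n `&` D)) (j p) by exists p.
    have H : nbhs p [set u | D u -> (j @` (K n `&` D)) (j u) -> A (j u)].
      exact: cj Dp _ (HA n (j p) jKp (DA Dp)).
    by apply: filterS H => u H Ku Du; apply: H => //; exists u.
  by apply: filterS => _ [u [DA Du] <-]; exact: DA.
Qed.

End Transport.

Section Product.
Context {X Y : topologicalType} (x : X) (y : Y).

Lemma compact_nbhs_prod : compact_nbhs_at x -> compact_nbhs_at y ->
  compact_nbhs_at (x, y).
Proof.
move=> [K cK Kx] [L cL Ly]; exists (K `*` L); first exact: compact_setX.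
by apply/nbhs_prodP; exists K, L.
Qed.

Lemma first_countable_prod : first_countable_at x -> first_countable_at y ->
  first_countable_at (x, y).
Proof.
move=> [B [xB Bx]] [C [yC Cy]]; exists (fun n => B n `*` C n); split=> [n|U].
  by apply/nbhs_prodP; exists (B n), (C n).
move=> /nbhs_prodP[V [W [/Bx[n nV] /Cy[m mW] VW]]].
exists (maxn n m) => k; rewrite geq_max => /andP[nk mk] [u v] [/= Bu Cv].
by apply: VW; [exact: nV nk _ Bu|exact: mW mk _ Cv].
Qed.

(** Inside a set [A] that is open relative to all [K n * L n], Wallace's theorem
grows compact rectangles [P n * Q n], each a relative neighbourhood of the
preceding one. Their unions are neighbourhoods of [x] and of [y] by the k_omega
condition in each factor, and their product is contained in [A]. *)
Lemma komega_prod : regular_space X -> regular_space Y ->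
  komega_at x -> komega_at y -> komega_at (x, y).
Proof.
move=> rX rY [K [cK KS Kx KA]] [L [cL LS Ly LA]].
exists (fun n => K n `*` L n); split=> //.
- by move=> n; exact: compact_setX.
- by move=> n [u v] [/= Ku Lv]; split; [exact: KS|exact: LS].
move=> A Axy HA.
pose inv n (PQ : set X * set Y) := [/\ compact PQ.1, compact PQ.2,
  PQ.1 `<=` K n, PQ.2 `<=` L n & PQ.1 `*` PQ.2 `<=` A].
pose link n (PQ PQ' : set X * set Y) := [/\
  forall p, PQ.1 p -> within (K n) (nbhs p) PQ'.1 &
  forall q, PQ.2 q -> within (L n) (nbhs q) PQ'.2].
have step n PQ : inv n PQ -> exists PQ', inv n.+1 PQ' /\ link n.+1 PQ PQ'.
  move: PQ => [P Q] [/= cP cQ PK QL PQA].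
  have [|U [V [PU QV UV]]] := @wallace _ _ P Q
      [set p | (K n.+1 `*` L n.+1) p -> A p] cP cQ.
    move=> p q Pp Qq; apply: (HA n.+1 (p, q)); last exact: PQA.
    by split; [exact/KS/PK|exact/LS/QL].
  have [C [cC CU PC]] := set_nbhs_closed rX cP PU.
  have [D [cD DV QD]] := set_nbhs_closed rY cQ QV.
  exists (K n.+1 `&` C, L n.+1 `&` D); split; split => /=.
  - exact: compact_closedI.
  - exact: compact_closedI.
  - exact: subIsetl.
  - exact: subIsetl.
  - by move=> [u v] [/= [Ku Cu] [Lv Dv]]; apply: (UV u v (CU _ Cu) (DV _ Dv)).
  - by move=> p /PC; apply: filterS => u Cu Ku.
  - by move=> q /QD; apply: filterS => u Du Lu.
(* By [step] the chosen pair exists for every pair that satisfies [inv]. *)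
pose next n PQ := xget (set0, set0) [set PQ' | inv n.+1 PQ' /\ link n.+1 PQ PQ'].
pose fix PQ n := if n is m.+1 then next m (PQ m) else ([set x], [set y]).
have PQi n : inv n (PQ n).
  elim: n => [|n IH]; last by have [] := xgetPex (set0, set0) (step n _ IH).
  split=> /=; [exact: compact_set1|exact: compact_set1|..].
  - by move=> _ ->.
  - by move=> _ ->.
  - by move=> [u v] [/= -> ->].
have PQl n : link n.+1 (PQ n) (PQ n.+1).
  by have [] := xgetPex (set0, set0) (step n _ (PQi n)).
have PS n : (PQ n).1 `<=` (PQ n.+1).1.
  move=> p Pp; have [_ _ PK _ _] := PQi n; have [H _] := PQl n.
  exact: nbhs_singleton (H p Pp) (KS _ _ (PK _ Pp)).
have QS n : (PQ n).2 `<=` (PQ n.+1).2.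
  move=> p Pp; have [_ _ _ QL _] := PQi n; have [_ H] := PQl n.
  exact: nbhs_singleton (H p Pp) (LS _ _ (QL _ Pp)).
apply/nbhs_prodP; exists (\bigcup_n (PQ n).1), (\bigcup_n (PQ n).2); split.
- apply: KA; first by exists 0%N.
  move=> n p Kp [m _ Pp]; pose N := maxn n m.
  have PNp : (PQ N).1 p by apply: (ascending_sub PS _ Pp); exact: leq_maxr.
  have [H _] := PQl N; apply: (@filterS _ (nbhs p) _ _ _ _ (H p PNp)) => u Hu Ku.
  exists N.+1 => //; apply: Hu; apply: (ascending_sub KS _ Ku).
  by rewrite leqW// leq_maxl.
- apply: LA; first by exists 0%N.
  move=> n p Kp [m _ Pp]; pose N := maxn n m.
  have PNp : (PQ N).2 p by apply: (ascending_sub QS _ Pp); exact: leq_maxr.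
  have [_ H] := PQl N; apply: (@filterS _ (nbhs p) _ _ _ _ (H p PNp)) => u Hu Ku.
  exists N.+1 => //; apply: Hu; apply: (ascending_sub LS _ Ku).
  by rewrite leqW// leq_maxl.
- move=> u v [n _ Pu] [m _ Qv]; pose N := maxn n m.
  have [_ _ _ _ +] := PQi N; apply; split=> /=.
    by apply: (ascending_sub PS _ Pu); exact: leq_maxl.
  by apply: (ascending_sub QS _ Qv); exact: leq_maxr.
Qed.

End Product.

(** * Joint continuity *)

(** The topology of [X * Y] at the point is determined by the subspaces [X * L] with
[L] compact. *)
Definition joint_at {X Y : topologicalType} (x : X) (y : Y) : Prop :=
  forall A : set (X * Y), A (x, y) ->
    (forall (L : set Y) (p : X * Y), compact L -> L p.2 -> A p ->
      within [set q | L q.2] (nbhs p) A) ->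
    nbhs (x, y) A.

Section Joint.
Context {X Y : topologicalType} (x : X) (y : Y).

Lemma compact_nbhs_joint : compact_nbhs_at y -> joint_at x y.
Proof.
move=> [L cL Ly] A Axy HA.
have H := HA L (x, y) cL (nbhs_singleton Ly) Axy.
have Lxy : nbhs (x, y) [set q : X * Y | L q.2].
  by apply/nbhs_prodP; exists setT, L; split=> //; exact: filterT.
by apply: (@filterS2 _ (nbhs (x, y)) _ _ _ _ _ H Lxy) => q /=; exact.
Qed.

Lemma komega_joint : komega_at (x, y) -> joint_at x y.
Proof.
move=> [K [cK KS Kxy KA]] A Axy HA; apply: KA => // n p Kp Ap.
have cL : compact (snd @` K n).
  apply: continuous_compact => //; apply: continuous_subspaceT => z.
  exact: cvg_snd.
have H := HA _ p cL (ex_intro2 _ _ p Kp erefl) Ap.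
by apply: (@filterS _ (nbhs p) _ _ _ _ H) => q /= Hq Kq; apply: Hq; exists q.
Qed.

Lemma compact_seq (u : nat -> Y) :
    (forall U, nbhs y U -> exists n, forall m, (n <= m)%N -> U (u m)) ->
  compact (y |` range u).
Proof.
move=> uy; apply/compact_near_coveringP => I G P FG HP.
have [[U V] /= [Uy GV] UV] := HP y (or_introl erefl).
have [n nU] := uy U Uy.
have Gn : G [set i | forall m : 'I_n, P i (u m)].
  apply: filter_forall => m.
  have [[U' V'] /= [Uu GV'] UV'] :=
    HP (u m) (or_intror (ex_intro2 _ _ _ Logic.I erefl)).
  apply: filterS GV' => i V'i; apply: (UV' (u m, i)); split => //.
  exact: nbhs_singleton.
apply: filterS2 GV Gn => i Vi Pi _ [->|[m _ <-]].
  by apply: (UV (y, i)); split=> //; exact: nbhs_singleton.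
have [mn|nm] := ltnP m n; first exact: (Pi (Ordinal mn)).
by apply: (UV (u m, i)); split=> //; exact: nU.
Qed.

(** If [A] were not a neighbourhood of [(x, y)], a sequence outside [A] would
converge to that point; its second components and [y] form a compact set [L],
and [A] is relatively open in [X * L]. *)
Lemma first_countable_joint : first_countable_at x -> first_countable_at y ->
  joint_at x y.
Proof.
move=> [B [xB Bx]] [C [yC Cy]] A Axy HA; apply: contrapT => nA.
have /choice[p Hp] n : exists p : X * Y, [/\ B n p.1, C n p.2 & ~ A p].
  apply: contra_notP nA => H; apply/nbhs_prodP; exists (B n), (C n); split=> //.
  by move=> u v Bu Cv; apply: contrapT => nAuv; apply: H; exists (u, v).
pose u n := (p n).2.
have cL : compact (y |` range u).
  apply: compact_seq => U /Cy[n nU]; exists n => m nm.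
  by have [_ Cp _] := Hp m; exact: nU nm _ Cp.
have /nbhs_prodP[U [V [/Bx[n nU] /Cy[m mV] UV]]] :=
  HA _ (x, y) cL (or_introl erefl) Axy.
have [Bp Cp nAp] := Hp (maxn n m); apply: nAp.
move: Bp Cp (UV (p (maxn n m)).1 (p (maxn n m)).2).
case E : (p _) => [a b] /= Ba Cb; apply.
- by apply: nU Ba; exact: leq_maxl.
- by apply: mV Cb; exact: leq_maxr.
- by right; exists (maxn n m) => //; rewrite /u E.
Qed.

End Joint.

(** Over a compact [L], restrict to the part of [L] on which [b x1] stays close to
[b x1 y1]: this part is compact, and compact-open continuity controls [b x']
on it for [x'] near [x1]. *)
Lemma joint_continuous {X Y : topologicalType} {F : uniformType}
    (b : X -> Y -> F) (x : X) (y : Y) : joint_at x y ->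
    (forall x, continuous (b x)) -> (forall x, co_cvg (nbhs x) b (b x)) ->
  (fun p : X * Y => b p.1 p.2) @ (x, y) --> b x y.
Proof.
move=> Jxy bc cb U /nbhs_interior Uxy.
have oU : open U° by exact: open_interior.
suff : nbhs (x, y) [set p : X * Y | U° (b p.1 p.2)].
  by apply: filterS => p /interior_subset.
apply: Jxy; first exact: nbhs_singleton Uxy.
move=> L [x1 y1] cL /= Ly1 Up.
have Ubp : nbhs (b x1 y1) U° by apply: open_nbhs_nbhs.
have [B Bp BU] := @uniform_regular F (b x1 y1) _ Ubp.
pose K := L `&` b x1 @^-1` closure B.
have cK : compact K.
  apply: compact_closedI => //; apply: preimage_closed; last exact: closed_closure.
  by move=> z _; exact: bc.
have KU : b x1 @` K `<=` U° by move=> _ [z [_ Bz] <-]; exact: BU.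
apply/nbhs_prodP; exists [set x' | b x' @` K `<=` U°], (b x1 @^-1` B); split.
- exact: cb.
- exact: bc.
- move=> x' y' /= KU' By' Ly'; apply: KU'; exists y' => //.
  by split=> //; exact: subset_closure.
Qed.

(** * Finite powers *)

Section Powers.
Context {E : uniformType}.

Lemma ptws_cvg {T : Type} (G : set_system T) I (f : T -> {ptws I -> E})
    (l : {ptws I -> E}) : Filter G ->
  (forall i, (fun t => f t i) @ G --> l i) -> f @ G --> l.
Proof.
move=> FG H; apply/cvg_sup => i; apply/initial_cvgP; exact: H.
Qed.

Lemma ptws_proj_cvg {I : eqType} (l : {ptws I -> E}) i :
  (fun f : {ptws I -> E} => f i) @ l --> l i.
Proof. exact: (@proj_continuous I (fun=> E) i l). Qed.

Definition ptws_cons k (p : E * {ptws 'I_k -> E}) : {ptws 'I_k.+1 -> E} :=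
  fun i => oapp p.2 p.1 (unlift ord0 i).

Definition ptws_uncons k (f : {ptws 'I_k.+1 -> E}) : E * {ptws 'I_k -> E} :=
  (f ord0, fun i => f (lift ord0 i)).

Lemma ptws_unconsK k : cancel (@ptws_uncons k) (@ptws_cons k).
Proof.
move=> f; apply/funext => i; rewrite /ptws_cons /=.
by case: unliftP => [j|] ->.
Qed.

Lemma ptws_consK k : cancel (@ptws_cons k) (@ptws_uncons k).
Proof.
move=> [e f]; rewrite /ptws_uncons /ptws_cons unlift_none /=; congr pair.
by apply/funext => i; rewrite liftK.
Qed.

Lemma ptws_cons_cvg k (p : E * {ptws 'I_k -> E}) : @ptws_cons k @ p --> ptws_cons p.
Proof.
apply: ptws_cvg => i; rewrite /ptws_cons; case: (unlift ord0 i) => [j|] /=.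
  apply: (@cvg_comp_at _ {ptws 'I_k -> E} E _ snd (fun f => f j)).
    exact: cvg_snd.
  exact: ptws_proj_cvg.
exact: cvg_fst.
Qed.

Lemma ptws_uncons_cvg k (f : {ptws 'I_k.+1 -> E}) :
  @ptws_uncons k @ f --> ptws_uncons f.
Proof.
apply: (@cvg_pair_at _ E {ptws 'I_k -> E} (nbhs f) (fun f => f ord0)
  (fun f i => f (lift ord0 i))); first exact: (@ptws_proj_cvg 'I_k.+1 f ord0).
by apply: ptws_cvg => i; exact: (@ptws_proj_cvg 'I_k.+1 f (lift ord0 i)).
Qed.

Lemma ptws_cons_open k (p : E * {ptws 'I_k -> E}) A : nbhs p A ->
  nbhs (ptws_cons p) (@ptws_cons k @` (A `&` setT)).
Proof.
move=> Ap; have := @ptws_uncons_cvg k (ptws_cons p).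
rewrite ptws_consK => /(_ A Ap) H.
apply: (@filterS _ (nbhs (ptws_cons p)) _ _ _ _ H) => f /= Af.
by exists (ptws_uncons f) => //; exact: ptws_unconsK.
Qed.

(** Splitting off one coordinate reduces a power to a binary product. *)
Lemma power_ind (P : forall T : topologicalType, T -> Prop) :
    (forall f : {ptws 'I_0 -> E}, P _ f) ->
    (forall k (e : E) (f : {ptws 'I_k -> E}), P _ e -> P _ f ->
      P (E * {ptws 'I_k -> E})%type (e, f)) ->
    (forall k (p : E * {ptws 'I_k -> E}), P _ p -> P _ (ptws_cons p)) ->
  (forall e : E, P _ e) -> forall k (f : {ptws 'I_k -> E}), P _ f.
Proof.
move=> P0 PX Pj PE; elim=> [|k IH] f; first exact: P0.
by rewrite -(ptws_unconsK f); apply: Pj; apply: PX.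
Qed.

Lemma ptws0_nbhs (f : {ptws 'I_0 -> E}) (A : set {ptws 'I_0 -> E}) : A f -> A = setT.
Proof.
move=> Af; apply/seteqP; split=> // g _.
by have -> : g = f by apply/funext => -[].
Qed.

Lemma ptws0_compact : compact [set: {ptws 'I_0 -> E}].
Proof.
pose f : {ptws 'I_0 -> E} := fun i => False_rect E (notF (ltn_ord i)).
suff -> : [set: {ptws 'I_0 -> E}] = [set f] by exact: compact_set1.
by rewrite predeqE => g; split=> // _ /=; apply/funext => -[].
Qed.

Let cons_within k (p : E * {ptws 'I_k -> E}) :
  @ptws_cons k @ within setT (nbhs p) --> ptws_cons p.
Proof.
move=> A /ptws_cons_cvg H.
by apply: (@filterS _ (nbhs p) _ _ _ _ H) => q Aq _.
Qed.

Lemma compact_nbhs_power : (forall e : E, compact_nbhs_at e) ->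
  forall k (f : {ptws 'I_k -> E}), compact_nbhs_at f.
Proof.
apply: (@power_ind (@compact_nbhs_at)) => [f|k e f|k p].
- by exists setT; [exact: ptws0_compact|exact: filterT].
- exact: compact_nbhs_prod.
- apply: (@compact_nbhs_transport _ _ p (@ptws_cons k) setT) => //.
  + by move=> u _; exact: cons_within.
  + by move=> A; exact: ptws_cons_open.
Qed.

Lemma first_countable_power : (forall e : E, first_countable_at e) ->
  forall k (f : {ptws 'I_k -> E}), first_countable_at f.
Proof.
apply: (@power_ind (@first_countable_at)) => [f|k e f|k p].
- exists (fun=> setT); split=> [n|U /nbhs_singleton Uf]; first exact: filterT.
  by exists 0%N => m _; rewrite (ptws0_nbhs Uf).
- exact: first_countable_prod.
- apply: (@first_countable_transport _ _ p (@ptws_cons k) setT) => //.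
  + by move=> u _; exact: cons_within.
  + by move=> A; exact: ptws_cons_open.
Qed.

Lemma komega_power : (forall e : E, komega_at e) ->
  forall k (f : {ptws 'I_k -> E}), komega_at f.
Proof.
apply: (@power_ind (@komega_at)) => [f|k e f|k p].
- exists (fun=> setT); split=> // [n|A Af _]; first exact: ptws0_compact.
  by rewrite (ptws0_nbhs Af); exact: filterT.
- by apply: komega_prod; exact: uniform_regular.
- apply: (@komega_transport _ _ p (@ptws_cons k) setT) => //.
  + by move=> u _; exact: cons_within.
  + by move=> A; exact: ptws_cons_open.
Qed.

End Powers.

(** * Metrizable spaces and hemicompact k-spaces *)

Lemma first_countable_set {E : topologicalType} (V : set E) (v : V) :
  first_countable_at (set_val v) -> first_countable_at v.
Proof.
move=> [B [vB Bv]]; exists (fun n => set_val @^-1` B n); split=> [n|U].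
  exact: (@initial_continuous V E set_val v).
move=> [_ [[A oA <-] /= Av AU]].
have [n nA] := Bv A (open_nbhs_nbhs (conj oA Av)).
by exists n => m nm u Bu; apply: AU; exact: nA nm _ Bu.
Qed.

Lemma metrizable_first_countable {R : realType} (T : topologicalType) :
  metrizable R T -> forall z : T, first_countable_at z.
Proof.
move=> [d [d0 _ _ dn]] z.
exists (fun n => [set y | d z y < n.+1%:R^-1]); split=> [n|U].
  by apply/dn; exists n.+1%:R^-1 => //; rewrite invr_gt0 ltr0n.
move=> /dn[e e0 eU].
have [n ne] : exists n : nat, n.+1%:R^-1 < e.
  exists (Num.truncn e^-1).
  by rewrite invf_plt ?posrE ?ltr0n// truncnS_gt.
exists n => m nm y /= dy; apply: eU; apply: (lt_trans dy).
by apply: le_lt_trans ne; rewrite lef_pV2 ?posrE ?ltr0n// ler_nat ltnS.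
Qed.

Lemma hemicompact_k_komega (T : topologicalType) :
  hemicompact T -> k_space T -> forall z : T, komega_at z.
Proof.
move=> [K [cK KS KT KC]] [_ kT] z.
have [n0 _ Kz] : (\bigcup_n K n) z by rewrite KT.
(* The sequence is shifted so that its first set contains [z]. *)
exists (fun n => K (n + n0)%N); split.
- by move=> n; exact: cK.
- by move=> n; exact: (KS (n + n0)%N).
- by [].
- move=> A Az HA; apply: open_nbhs_nbhs; split=> //; apply/kT => C cC.
  have [n Cn] := KC C cC.
  rewrite openE => c Ac.
  have Kc : K (n + n0)%N (set_val c).
    apply: (ascending_sub KS (leq_addr n0 n)); apply: Cn; exact: set_valP.
  have : nbhs (set_val c) [set u | K (n + n0)%N u -> A u] := HA n _ Kc Ac.
  rewrite nbhsE => -[B [oB Bc] BA].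
  have Bc' : nbhs c (set_val @^-1` B).
    by apply: (@initial_continuous C T set_val c); exact: open_nbhs_nbhs.
  apply: (@filterS _ (nbhs c) _ _ _ _ Bc') => c' Bc''.
  apply: BA => //; apply: (ascending_sub KS (leq_addr n0 n)).
  by apply: Cn; exact: set_valP.
Qed.

(** * Finite-dimensional spaces *)

Section FiniteDimension.
Context {R : realType} {E : lcsType R}.

Definition lincomb n (b : 'I_n -> E) (c : {ptws 'I_n -> R}) : E :=
  \sum_(i < n) c i *: b i.

Lemma lincomb_cvg (T : Type) (G : set_system T) n (b : 'I_n -> E)
    (f : T -> 'I_n -> R) (c : 'I_n -> R) : Filter G ->
  (forall i, (fun t => f t i) @ G --> c i) ->
  (fun t => lincomb b (f t)) @ G --> lincomb b c.
Proof.
move=> FG fc; rewrite /lincomb; elim: (index_enum _) => [|i l IH].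
  have -> : (fun t => \sum_(i <- [::]) f t i *: b i) = cst 0.
    by apply/funext => t; rewrite big_nil.
  by rewrite big_nil; exact: cvg_cst.
have -> : (fun t => \sum_(i <- i :: l) f t i *: b i) =
    (fun t => f t i *: b i + \sum_(i <- l) f t i *: b i).
  by apply/funext => t; rewrite big_cons.
rewrite big_cons; apply: tvs_cvgD; last exact: IH.
by apply: tvs_cvgZ; [exact: fc|exact: cvg_cst].
Qed.

Lemma lincomb_continuous n (b : 'I_n -> E) : continuous (lincomb b).
Proof.
move=> c; apply: (@lincomb_cvg _ (nbhs c) n b id c) => i.
exact: (@ptws_proj_cvg R 'I_n c i).
Qed.

(** A spanning family of minimal length is free. *)
Lemma free_spanning : finite_dimensional E ->
  exists n (b : 'I_n -> E), (forall x, exists c, x = lincomb b c) /\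
    (forall c, lincomb b c = 0 -> forall i, c i = 0).
Proof.
move=> [n0 [b0 b0E]].
pose P n := `[< exists b : 'I_n -> E, forall x, exists c, x = lincomb b c >].
have exP : exists n, P n by exists n0; apply/asboolP; exists b0.
case: (ex_minnP exP) => n /asboolP[b bE] nmin.
exists n, b; split=> // c c0 i0; apply: contrapT => /eqP ci0.
case: n => [|n] in b bE nmin c c0 i0 ci0 *; first by case: i0 ci0.
suff /nmin : P n by rewrite ltnn.
apply/asboolP; exists (fun j => b (lift i0 j)) => x.
have [d ->] := bE x.
exists (fun j => d (lift i0 j) - d i0 * (c i0)^-1 * c (lift i0 j)).
have bi0 : b i0 = - ((c i0)^-1 *: \sum_(j < n) c (lift i0 j) *: b (lift i0 j)).
  move: c0; rewrite /lincomb (bigD1_ord i0)//= => /eqP.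
  rewrite addrC addr_eq0 => /eqP ->.
  by rewrite scalerN opprK scalerA mulVf// scale1r.
rewrite /lincomb (bigD1_ord i0)//= bi0 scalerN scalerA scaler_sumr.
rewrite -sumrN -big_split /=; apply: eq_bigr => j _.
by rewrite scalerA scalerBl addrC.
Qed.

(** For coordinates with respect to a basis, the image [lincomb b @` S] of the
boundary [S] of the cube is compact and misses 0, so that some convex
neighbourhood of 0 avoids it. A point of this neighbourhood outside the image
of the cube could be scaled down onto the image of [S]. *)
Lemma finite_dimensional_compact0 : finite_dimensional E ->
  compact_nbhs_at (0 : E).
Proof.
move=> /free_spanning[n [b [bE b0]]].
pose box : set {ptws 'I_n -> R} := [set c | forall i, `[-1, 1]%classic (c i)].
have cbox : compact box.
  apply: (@tychonoff 'I_n (fun=> R : topologicalType) (fun=> `[-1, 1]%classic)) => i.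
  exact: segment_compact.
pose O1 : set {ptws 'I_n -> R} := [set c | forall i, `|c i| < 1].
have oO1 : open O1.
  rewrite openE => c Oc.
  apply: (@filter_forall _ 'I_n (fun i c => `|c i| < 1) (nbhs c)) => i.
  have H : nbhs (c i) [set t : R | `|t| < 1].
    exact: (@cvgr_lt _ _ (nbhs (c i)) _ _ _ (@norm_continuous R R^o (c i)) _ (Oc i)).
  exact: (@ptws_proj_cvg R 'I_n c i) _ H.
pose S := box `&` ~` O1.
have cTS : compact (lincomb b @` S).
  apply: continuous_compact.
    by apply: continuous_subspaceT; exact: lincomb_continuous.
  by apply: compact_closedI => //; exact: open_closedC.
have Z0 : nbhs (0 : E) (~` (lincomb b @` S)).
  apply: open_nbhs_nbhs; split.
    by apply: closed_openC; apply: compact_closed => //; exact: is_hausdorff.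
  move=> [c [_ nO] c0]; apply: nO => i.
  by rewrite (b0 _ c0) normr0.
have [A [oA cA A0 AZ]] := lcs_nbhs Z0.
exists (lincomb b @` box).
  apply: continuous_compact => //.
  by apply: continuous_subspaceT; exact: lincomb_continuous.
apply: filterS (open_nbhs_nbhs (conj oA A0)) => u Au.
have [c uc] := bE u; exists c => // => i; rewrite /= in_itv /= -ler_norml.
rewrite leNgt; apply/negP => ci1.
have [i0 _ i0max] := @arg_maxP _ _ _ i xpredT (fun i => `|c i|) isT.
have m1 : 1 < `|c i0| by apply: lt_le_trans ci1 _; exact: i0max.
have m0 : 0 < `|c i0| by exact: lt_trans m1.
apply: (AZ (`|c i0|^-1 *: u)).
  apply: subset_closure; rewrite -[X in A X]addr0 -(scaler0 _ (1 - `|c i0|^-1)).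
  by apply: cA => //; rewrite ?invr_ge0 ?(ltW m0)// invf_le1// ltW.
exists (fun i => `|c i0|^-1 * c i).
  split=> [k|/(_ i0)] /=.
    rewrite in_itv /= -ler_norml normrM ger0_norm ?invr_ge0 ?(ltW m0)//.
    by rewrite ler_pdivrMl// mulr1; exact: i0max.
  rewrite normrM ger0_norm ?invr_ge0 ?(ltW m0)//.
  by rewrite mulVf ?gt_eqF// ltxx.
rewrite uc /lincomb scaler_sumr; apply: eq_bigr => k _.
by rewrite scalerA.
Qed.

Lemma finite_dimensional_compact (e : E) : finite_dimensional E ->
  compact_nbhs_at e.
Proof.
move=> /finite_dimensional_compact0 H; rewrite -[e]addr0.
apply: (@compact_nbhs_transport _ _ (0 : E) (fun u => e + u) setT) => //.
- move=> u _ U eU; have c : (fun u => e + u) @ u --> e + u.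
    by apply: tvs_cvgD; [exact: cvg_cst|exact: cvg_id].
  by apply: (@filterS _ (nbhs u) _ _ _ _ (c U eU)) => z Uz _.
- move=> A A0.
  have c : (fun u => - e + u) @ (e + 0) --> - e + (e + 0).
    by apply: tvs_cvgD; [exact: cvg_cst|exact: cvg_id].
  rewrite addr0 addNr in c; rewrite addr0.
  apply: (@filterS _ (nbhs e) _ _ _ _ (c A A0)) => u Au.
  by exists (- e + u) => //; rewrite addrA subrr add0r.
Qed.

End FiniteDimension.

(** * Charts of manifolds with corners *)

Section CornerCharts.
Context {R : realType} {E : lcsType R} (M : manifold E).
Variable P : forall T : topologicalType, T -> Prop.
Hypothesis PT : forall (S T : topologicalType) (z : S) (j : S -> T) (D : set S),
  D z -> (forall u, D u -> j @ within D (nbhs u) --> j u) ->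
  (forall A, nbhs z A -> nbhs (j z) (j @` (A `&` D))) -> closed D ->
  P z -> P (j z).
Hypothesis PE : forall e : E, P e.

(** Stated for any condition that can be carried along a change of charts, so as to
serve for compact neighbourhoods as well as for the k_omega condition. The
corner chart at a point may differ from [phi], which need not be a corner
chart itself. The set [D] is the part of the corner lying in a small closed
neighbourhood; it is mapped into the codomain of [phi] by the change of charts. *)
Lemma corner_chart_at (phi : chart E M) (v : chart_cod phi) :
  with_corners M -> P v.
Proof.
move=> wc; pose x := set_val (chart_inv v).
have [phi' aphi' dx] := atlas_cover x.
have [v' v'x] := chart_fromP dx.
pose q (u : chart_cod phi') : M := set_val (chart_inv u).
have qv' : q v' = x by move: v'x; rewrite chart_from_dom => -[].
have cq : continuous q.
  move=> u; apply: (@cvg_comp_at _ _ _ (nbhs u) (@chart_inv _ _ _ phi') set_val).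
    exact: chart_inv_continuous.
  exact: initial_continuous.
have [n [lam [clam _ [B oB VB]]]] := wc _ aphi'.
pose C := [set u : E | forall i, 0 <= lam i u].
have Ux : chart_dom phi (q v') by rewrite qv'; exact: set_valP.
have [_ [[B1 oB1 <-] /= B1v B1q]] :=
  cq v' _ (open_nbhs_nbhs (conj (@chart_dom_open _ _ _ phi) Ux)).
have v'BC : (B `&` C) (set_val v') by rewrite -VB; exact: set_valP.
have nB : nbhs (set_val v') (B `&` B1).
  by apply: open_nbhs_nbhs; split; [exact: openI|split=> //; exact: v'BC.1].
have [N Nv' NB] := @uniform_regular E (set_val v') _ nB.
pose D := closure N `&` C.
have DV u : D u -> chart_cod phi' u.
  by move=> [/NB[Bu _] Cu]; rewrite VB.
(* The change of charts, made total by [to_set]; it is meaningful on [D]. *)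
pose j (u : E) : chart_cod phi :=
  chart_map (to_set (chart_inv v) (q (to_set v' u))).
have jE : j (set_val v') = v.
  by rewrite /j set_valK qv' set_valK chart_invK.
rewrite -jE; apply: (@PT E (chart_cod phi) (set_val v') j D).
- by split; [exact: subset_closure (nbhs_singleton Nv')|exact: v'BC.2].
- move=> u Du.
  apply: (@cvg_comp_at _ (chart_dom phi) _ (within D (nbhs u))
    (fun u => to_set (chart_inv v) (q (to_set v' u))) (@chart_map _ _ _ phi));
    last exact: chart_map_continuous.
  apply: (@cvg_comp_at _ M _ (within D (nbhs u))
    (fun u => q (to_set v' u)) (to_set (chart_inv v))); last first.
    apply: to_set_cvg; apply: open_nbhs_nbhs; split; first exact: chart_dom_open.
    by apply: B1q; rewrite /= to_setK; [exact: (NB _ Du.1).2|exact: DV].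
  apply: (@cvg_comp_at _ (chart_cod phi') _ (within D (nbhs u))
    (to_set v') q); last exact: cq.
  move=> U nU; have H := @to_set_within _ _ v' u (DV u Du) U nU.
  by apply: (@filterS _ (nbhs u) _ _ _ _ H) => z + /DV; exact.
- move=> A Av'.
  rewrite jE.
  (* The inverse change of charts [i] shows that [j] is open at the point. *)
  pose w2 (v2 : chart_cod phi) : M := set_val (chart_inv v2).
  have cw2 : w2 @ v --> w2 v.
    apply: (@cvg_comp_at _ _ _ (nbhs v) (@chart_inv _ _ _ phi) set_val).
      exact: chart_inv_continuous.
    exact: initial_continuous.
  pose i v2 : E := set_val (chart_map (to_set (chart_inv v') (w2 v2))).
  have w2v : w2 v = q v' by rewrite qv'.
  have U'v : (chart_dom phi') (w2 v) by exact: dx.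
  have iv : i v = set_val v' by rewrite /i w2v /q set_valK chart_invK.
  have ci : i @ v --> i v.
    apply: (@cvg_comp_at _ (chart_cod phi') _ (nbhs v)
      (fun v2 => chart_map (to_set (chart_inv v') (w2 v2))) set_val);
      last exact: initial_continuous.
    apply: (@cvg_comp_at _ (chart_dom phi') _ (nbhs v)
      (fun v2 => to_set (chart_inv v') (w2 v2)) (@chart_map _ _ _ phi'));
      last exact: chart_map_continuous.
    apply: (@cvg_comp_at _ M _ (nbhs v) w2 (to_set (chart_inv v'))) => //.
    apply: to_set_cvg; apply: open_nbhs_nbhs; split=> //.
    exact: chart_dom_open.
  have n1 : nbhs v [set v2 | (A `&` N) (i v2)].
    by apply: ci; rewrite iv; exact: filterI.
  have n2 : nbhs v [set v2 | chart_dom phi' (w2 v2)].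
    by apply: cw2; apply: open_nbhs_nbhs; split=> //; exact: chart_dom_open.
  apply: (@filterS2 _ (nbhs v) _ _ _ _ _ n1 n2) => v2 /= [Ai Ni] U'2.
  exists (i v2).
    split=> //; split; first exact: subset_closure.
    suff : (B `&` C) (i v2) by case.
    by rewrite -VB; exact: set_valP.
  rewrite /j {1}/i set_valK /q chart_mapK to_setK// set_valK chart_invK//.
- apply: closedI; first exact: closed_closure.
  rewrite (_ : C = \bigcap_(i in setT) [set u | 0 <= lam i u]); last first.
    by apply/seteqP; split=> u /= Cu i; [move=> _|]; exact: Cu.
  apply: closed_bigI => i _.
  apply: (@preimage_closed _ _ (lam i) [set t : R^o | 0 <= t]).
    by move=> u _; exact: clam.
  exact: closed_ge.
- exact: PE.
Qed.

End CornerCharts.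

(** * Uniform convergence on compact sets *)

Section CoCvgUniform.
Context {R : realType} {X : topologicalType} {F : lcsType R}.

(** For a continuous limit, compact-open convergence is uniform convergence on
compact sets, the form compatible with the linear structure. *)
Lemma co_cvgP (T : Type) (G : set_system T) (A : T -> X -> F) (h : X -> F) :
    Filter G -> continuous h ->
  co_cvg G A h <-> forall (K : set X) (U : set F), compact K -> nbhs 0 U ->
    G [set t | forall x, K x -> U (A t x - h x)].
Proof.
move=> FG ch; split=> [Ah K U cK U0|Ah K B cK oB hKB].
  have /compact_near_coveringP/near_covering_withinP := cK.
  move=> /(_ T G (fun t x => U (A t x - h x)) FG) H.
  apply: H => x Kx.
  have [V V0 VU] := tvs_nbhsB U0.
  have [B [oB cB Bx BV]] := lcs_nbhs (tvs_nbhs_shift (h x) V0).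
  have nB : nbhs (h x) B by apply: open_nbhs_nbhs.
  have [C Cx CB] := @uniform_regular F (h x) _ nB.
  pose K' := K `&` h @^-1` closure C.
  have cK' : compact K'.
    apply: compact_closedI => //; apply: preimage_closed; last exact: closed_closure.
    by move=> z _; exact: ch.
  have hK' : h @` K' `<=` B by move=> _ [z [_ Cz] <-]; exact: CB.
  exists (h @^-1` C, [set t | A t @` K' `<=` B]).
    by split; [exact: ch|exact: Ah].
  move=> [z t] [/= Cz AB] Kz.
  have K'z : K' z by split=> //; exact: subset_closure.
  have -> : A t z - h z = (A t z - h x) - (h z - h x) by rewrite opprB addrA subrK.
  apply: VU; apply: BV; apply: subset_closure.
    by apply: AB; exists z.
  by apply: hK'; exists z.
have [|p Kp|U U0 KU] := @compact_tube X F K (nbhs (0 : F))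
    (fun x U => forall u, U u -> B (h x + u)) _ cK.
- by move=> x H H' HH' H'B u /HH'; exact: H'B.
- have Bp : nbhs (h p) B by apply: open_nbhs_nbhs; split=> //; apply: hKB; exists p.
  have [C [D [Cp D0 CD]]] := tvs_nbhs_add Bp.
  exists D => //; apply: (@filterS _ (nbhs p) _ _ _ _ (ch p _ Cp)) => x Cx u Du.
  exact: CD.
apply: filterS (Ah K U cK U0) => t AU _ [x Kx <-].
rewrite -(subrK (h x) (A t x)) addrC.
by apply: (nbhs_singleton (KU x Kx)); exact: AU.
Qed.

End CoCvgUniform.

(** * Derivatives and continuous linear maps *)

Section LinearDerivative.
Context {R : realType} {E : lcsType R} {F1 F2 : lcsType R} (L : F1 -> F2).
Hypothesis cL : continuous L.
Hypothesis linL : forall c a b, L (c *: (a - b)) = c *: (L a - L b).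

Lemma is_dderive_linear (f : E -> F1) h x l :
  is_dderive f h x l -> is_dderive (L \o f) h x (L l).
Proof.
rewrite /is_dderive => fl.
have -> : (fun t : R => t^-1 *: ((L \o f) (x + t *: h) - (L \o f) x)) =
    (fun t : R => L (t^-1 *: (f (x + t *: h) - f x))).
  by apply/funext => t; rewrite linL.
exact: (@cvg_comp_at _ _ _ _ _ L _ _ fl (@cL l)).
Qed.

Lemma iter_dderive_linear (U : set E) (f : E -> F1) hs : open U ->
    iter_dderivable U f hs ->
  iter_dderivable U (L \o f) hs /\
  forall x, U x -> iter_dderive (L \o f) hs x = L (iter_dderive f hs x).
Proof.
move=> oU; elim: hs f => [//|h hs IH] f /= [df dfs].
have dL x : U x -> is_dderive (L \o f) h x ((L \o dderive f h) x).
  by move=> Ux; apply: is_dderive_linear; apply: dderive_is; exact: df.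
have [d1 e1] := IH _ dfs.
have e x : U x -> (L \o dderive f h) x = dderive (L \o f) h x.
  by move=> Ux; rewrite (dderiveE (dL x Ux)).
have [d2 e2] := iter_dderive_local oU e d1.
split; first by split=> // x Ux; eexists; exact: dL.
by move=> x Ux; rewrite -e2// e1.
Qed.

End LinearDerivative.

(** * Uncurrying a C^r-map *)

Section Uncurry.
Context {R : realType} {E1 E2 F : lcsType R} (r s : option nat).
Context (M1 : manifold E1) (M2 : manifold E2) (g : M1 -> Crmap s M2 F).
Hypothesis Cg : is_Cr_map r g.
Context (phi : chart E1 M1) (psi : chart E2 M2).
Hypotheses (Mphi : charts phi) (Mpsi : charts psi).
Local Notation V := (chart_cod phi).
Local Notation W := (chart_cod psi).
Hypothesis JVW : forall i j (p : Cr_dom V i) (q : Cr_dom W j), joint_at p q.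
Local Notation G := (in_chart phi g).
Local Notation f := (in_charts phi psi (fun p : M1 * M2 => g p.1 p.2)).

Let r0 : order_le 0 r. Proof. by case: (r). Qed.
Let s0 : order_le 0 s. Proof. by case: (s). Qed.

Lemma in_charts_uncurry x : (fun y => f (x, y)) = in_chart psi (G x).
Proof.
apply/funext => y; rewrite /in_charts /in_chart /=.
by case: (chart_from phi x) => [x1|] /=; case: (chart_from psi y).
Qed.

Let b i j (p : Cr_dom V i) (q : Cr_dom W j) : F :=
  dk W (in_chart psi (dk V G i p)) j q.

(* [b] is continuous in [p] for the compact-open topology; the uncurried map is
   then continuous by the hypothesis [JVW]. *)
Let b_continuous i j : order_le i r -> order_le j s ->
  forall p q, (fun z : Cr_dom V i * Cr_dom W j => b z.1 z.2) @ (p, q) --> b p q.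
Proof.
move=> ir js p q; apply: joint_continuous; first exact: JVW.
  by move=> p'; exact: Crmap_dk_continuous.
move=> p'; have [c _] := dk_is (Cg Mphi) ir.
have := (@Crmap_cvgP R E2 F s M2 (Cr_dom V i) (nbhs p') (dk V G i)
  (dk V G i p') _).1 (c p').
by apply.
Qed.

(* For fixed interior [y], a derivative of [f] in the second variable is a linear
   functional of the value [G x]. *)
Let iter_snd j (u : 'I_j -> E2) y : order_le j s -> forall Wy : W° y,
  (fun x => iter_dderive f [seq (0, h) | h <- Cr_dirs u] (x, y)) =
  (fun A : Crmap s M2 F => dk W (in_chart psi A) j
     (exist _ y (mem_set (interior_subset Wy)), u)) \o G.
Proof.
move=> js Wy; apply/funext => x /=.
rewrite iter_dderive_snd in_charts_uncurry.
by rewrite (dk_int_eq _ (Crmap_in_chart (G x) Mpsi) js).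
Qed.

Let iter_uncurry i j (w : 'I_i -> E1) (u : 'I_j -> E2) :
    order_le i r -> order_le j s ->
  iter_dderivable (V° `*` W°) f (Crs_dirs w u) /\
  forall (v : V) (y : W), V° (set_val v) -> W° (set_val y) ->
    iter_dderive f (Crs_dirs w u) (set_val v, set_val y) =
    b ((v, w) : Cr_dom V i) ((y, u) : Cr_dom W j).
Proof.
move=> ir js; rewrite Crs_dirsE.
have evc (q : Cr_dom W j) :
    continuous (fun A : Crmap s M2 F => dk W (in_chart psi A) j q).
  move=> A.
  have H := (@Crmap_cvgP R E2 F s M2 _ (nbhs A) id A _).1 cvg_id psi j Mpsi js.
  exact: (@co_cvg_at _ _ _ (nbhs A) (fun A => dk W (in_chart psi A) j) _ q _ (H _)).
have evl (q : Cr_dom W j) c (A B : Crmap s M2 F) :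
    dk W (in_chart psi (c *: (A - B))) j q =
    c *: (dk W (in_chart psi A) j q - dk W (in_chart psi B) j q).
  exact: Crmap_dkZB.
have [dG _] := (Cg Mphi).2 i ir.
have ev (q : Cr_dom W j) := @iter_dderive_linear R E1 _ _
  (fun A : Crmap s M2 F => dk W (in_chart psi A) j q) (evc q) (evl q) V° G
  (Cr_dirs w)  (@open_interior _ V) (dG w).
split.
  apply/iter_dderivable_cat; split.
    apply/iter_dderivable_snd => x Vx; rewrite in_charts_uncurry.
    exact: ((Crmap_in_chart (G x) Mpsi).2 j js).1.
  apply/iter_dderivable_fst => y Wy; rewrite (iter_snd u js Wy).
  exact: (ev _).1.
move=> v y Vv Wy; rewrite iter_dderive_cat iter_dderive_fst (iter_snd u js Wy).
rewrite (ev _).2// /b (dk_int_eq w (Cg Mphi) ir Vv).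
congr (dk _ _ _ (_, u)); apply: val_inj => /=.
by rewrite set_valE.
Qed.

(** The differential [d^(i,j)] of the uncurried map is [b i j] on the interior, and
[b i j] is continuous up to the boundary. *)
Lemma uncurry_is_Crs : is_Crs r s V W f.
Proof.
pose z1 : {ptws 'I_0 -> E1} := fun=> 0.
pose z2 : {ptws 'I_0 -> E2} := fun=> 0.
split.
  apply/subspace_sigL_continuousP.
  have -> : sigL (V `*` W) f =
      (fun vw : V * W => b (vw.1, z1) (vw.2, z2)) \o @setX_of_sigT _ _ V W.
    apply/funext => -[[x y] xy]; rewrite /sigL /= /b.
    have dV := @chart_cod_dense_interior _ _ _ phi.
    have dW := @chart_cod_dense_interior _ _ _ psi.
    rewrite (dk0 _ dV (Cg Mphi)) (dk0 _ dW (Crmap_in_chart _ Mpsi)).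
    rewrite -in_charts_uncurry /=.
    by rewrite !set_valE.
  move=> vw; apply: (@cvg_comp_at _ (V * W)%type _ (nbhs vw) (@setX_of_sigT _ _ V W)
    (fun vw : V * W => b (vw.1, z1) (vw.2, z2))).
    exact: setX_of_sigT_continuous.
  move: (@setX_of_sigT _ _ V W vw) => vy.
  have c := @b_continuous 0 0 r0 s0 (vy.1, z1) (vy.2, z2).
  apply: (@cvg_comp_at _ (Cr_dom V 0 * Cr_dom W 0)%type F (nbhs vy)
    (fun vw : V * W => ((vw.1, z1), (vw.2, z2))) (fun z => b z.1 z.2)
    ((vy.1, z1), (vy.2, z2)) _ _ c).
    apply: (@cvg_pair_at _ (Cr_dom V 0) (Cr_dom W 0)).
      apply: (@cvg_pair_at _ V {ptws 'I_0 -> E1} (nbhs vy) fst (fun=> z1)).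
        exact: cvg_fst.
      exact: cvg_cst.
    apply: (@cvg_pair_at _ W {ptws 'I_0 -> E2} (nbhs vy) snd (fun=> z2)).
      exact: cvg_snd.
    exact: cvg_cst.
move=> i j ir js; split; first by move=> w u; exact: (iter_uncurry w u ir js).1.
exists (fun p => b ((p.1.1, p.2.1) : Cr_dom V i)
  ((p.1.2, p.2.2) : Cr_dom W j)); split.
  move=> p.
  have c1 : (fun p : Crs_dom V W i j => p.1) @ p --> p.1 by exact: cvg_fst.
  have c2 : (fun p : Crs_dom V W i j => p.2) @ p --> p.2 by exact: cvg_snd.
  have c := @b_continuous i j ir js (p.1.1, p.2.1) (p.1.2, p.2.2).
  apply: (@cvg_comp_at _ (Cr_dom V i * Cr_dom W j)%type F (nbhs p)
    (fun p : Crs_dom V W i j => ((p.1.1, p.2.1), (p.1.2, p.2.2)))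
    (fun z => b z.1 z.2) ((p.1.1, p.2.1), (p.1.2, p.2.2)) _ _ c).
  apply: (@cvg_pair_at _ (Cr_dom V i) (Cr_dom W j)).
    apply: (@cvg_pair_at _ V {ptws 'I_i -> E1}).
      exact: (@cvg_comp_at _ _ V _ _ fst _ _ c1 (@cvg_fst _ _ _ _ _)).
    exact: (@cvg_comp_at _ _ {ptws 'I_i -> E1} _ _ fst _ _ c2 (@cvg_fst _ _ _ _ _)).
  apply: (@cvg_pair_at _ W {ptws 'I_j -> E2}).
    exact: (@cvg_comp_at _ _ W _ _ snd _ _ c1 (@cvg_snd _ _ _ _ _)).
  exact: (@cvg_comp_at _ _ {ptws 'I_j -> E2} _ _ snd _ _ c2 (@cvg_snd _ _ _ _ _)).
move=> [[v y] [w u]] /set_mem[/= Vv Wy].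
by rewrite /dij_int /= (iter_uncurry w u ir js).2.
Qed.

End Uncurry.

(** * The exponential law *)

Section ExponentialLaw.
Context {R : realType} {E1 E2 : lcsType R} (r s : option nat).
Context (M1 : manifold E1) (M2 : manifold E2) (F : lcsType R).

Lemma Crsmap_in_charts (f : Crsmap r s M1 M2 F) : is_Crs_map r s f.
Proof. by case: f => f /= /set_mem. Qed.

Lemma Crsmap_cvgP (T : Type) (G : set_system T) (A : T -> Crsmap r s M1 M2 F)
    (B : Crsmap r s M1 M2 F) : Filter G ->
  A @ G --> B <-> forall phi psi i j, charts phi -> charts psi ->
    order_le i r -> order_le j s ->
    co_cvg G
      (fun t => dij (chart_cod phi) (chart_cod psi) (in_charts phi psi (A t)) i j)
      (dij (chart_cod phi) (chart_cod psi) (in_charts phi psi B) i j).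
Proof.
move=> FG.
have H := @initial_co_cvgP _ _ _ _ (@Crsmap_dij R E1 E2 r s M1 M2 F) (A @ G) B _.
split=> [/H AB phi psi i j Mphi Mpsi ir js|AB].
  have ip : ((phi, psi), (i, j)) \in @Crs_index R E1 E2 r s M1 M2 by rewrite inE.
  exact: (AB (exist _ ((phi, psi), (i, j)) ip)).
apply/H => k; have [[Mphi Mpsi] [ir js]] := set_valP k.
exact: (AB _ _ _ _ Mphi Mpsi ir js).
Qed.

Lemma curry_in_Cr (f : Crsmap r s M1 M2 F) :
  curry_map (Crsmap_in_charts f) \in @Cr_pred R E1 r M1 (Crmap s M2 F).
Proof. by rewrite inE => phi Mphi; exact: curry_is_Cr. Qed.

Definition curry_Crsmap (f : Crsmap r s M1 M2 F) : Crmap r M1 (Crmap s M2 F) :=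
  MkCrmap (curry_in_Cr f).

Lemma curry_Crsmap_linear : linear curry_Crsmap.
Proof.
by move=> c f g; apply: Crmap_ext => x; apply: Crmap_ext.
Qed.

HB.instance Definition _ :=
  GRing.isLinear.Build R (Crsmap r s M1 M2 F) (Crmap r M1 (Crmap s M2 F)) _
    curry_Crsmap curry_Crsmap_linear.

Lemma dk_curry_Crsmap (f : Crsmap r s M1 M2 F) phi psi i j
    (p : Cr_dom (chart_cod phi) i) (q : Cr_dom (chart_cod psi) j) :
    charts phi -> charts psi -> order_le i r -> order_le j s ->
  dk (chart_cod psi) (in_chart psi
    (dk (chart_cod phi) (in_chart phi (curry_Crsmap f)) i p)) j q =
  dij (chart_cod phi) (chart_cod psi) (in_charts phi psi f) i j (interleave p q).
Proof.
move=> Mphi Mpsi ir js.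
by rewrite (dk_curry (Crsmap_in_charts f) Mphi p ir js Mpsi).
Qed.

Lemma Crmap_dkB (A B : Crmap s M2 F) psi j p : charts psi -> order_le j s ->
  dk (chart_cod psi) (in_chart psi (A - B)) j p =
  dk (chart_cod psi) (in_chart psi A) j p - dk (chart_cod psi) (in_chart psi B) j p.
Proof.
by move=> Mpsi js; rewrite -[A - B]scale1r Crmap_dkZB// scale1r.
Qed.

Lemma Crmap_dk0 psi j p : charts psi -> order_le j s ->
  dk (chart_cod psi) (in_chart psi (0 : Crmap s M2 F)) j p = 0.
Proof.
by move=> Mpsi js; rewrite -(subrr (0 : Crmap s M2 F)) Crmap_dkB// subrr.
Qed.

(** The sets [V] such that the differences of the differentials at [g] and at [f]
lie in [V] uniformly on [K], for [g] near [f], form a filter; continuity says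
that it converges to 0, which can be tested one differential at a time. *)
Lemma curry_Crsmap_continuous : continuous curry_Crsmap.
Proof.
move=> f.
apply: (@Crmap_cvgP R E1 _ r M1 _ (nbhs f) curry_Crsmap (curry_Crsmap f) _).2.
move=> phi i Mphi ir.
apply: (@co_cvgP _ _ _ _ (nbhs f) _ _ _ _).2; first exact: Crmap_dk_continuous.
move=> K U cK U0.
pose G' : set_system (Crmap s M2 F) := [set V |
  nbhs f [set g | forall p, K p ->
    V (dk (chart_cod phi) (in_chart phi (curry_Crsmap g)) i p -
       dk (chart_cod phi) (in_chart phi (curry_Crsmap f)) i p)]].
have FG' : Filter G'.
  split.
  - by apply: (@filterE _ (nbhs f)) => g p _.
  - move=> A B GA GB; apply: (@filterS2 _ (nbhs f) _ _ _ _ _ GA GB) => g gA gB p Kp.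
    by split; [exact: gA|exact: gB].
  - move=> A B AB GA; apply: (@filterS _ (nbhs f) _ _ _ _ GA) => g gA p Kp.
    by apply: AB; exact: gA.
suff : id @ G' --> (0 : Crmap s M2 F) by move=> /(_ U U0).
apply: (@Crmap_cvgP R E2 F s M2 _ G' id 0 _).2 => psi j Mpsi js.
apply: (@co_cvgP _ _ _ _ G' _ _ _ _).2; first exact: Crmap_dk_continuous.
move=> L W cL W0.
have [cf _] := dij_is (Crsmap_in_charts f Mphi Mpsi) ir js.
have H1 := (@Crsmap_cvgP _ (nbhs f) id f _).1 cvg_id phi psi i j Mphi Mpsi ir js.
pose m (z : Cr_dom (chart_cod phi) i * Cr_dom (chart_cod psi) j) :=
  interleave z.1 z.2.
have cKL : compact (m @` (K `*` L)).
  apply: continuous_compact; last exact: compact_setX.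
  apply: continuous_subspaceT => z; exact: interleave_continuous.
have H := (@co_cvgP _ _ _ _ (nbhs f) _ _ _ cf).1 (H1 _) _ W cKL W0.
apply: (@filterS _ (nbhs f) _ _ _ _ (H _ _)) => g gW p Kp q Lq.
rewrite Crmap_dkB// !dk_curry_Crsmap// Crmap_dk0// subr0.
by apply: gW; exists (p, q).
Qed.

Hypothesis J : forall (phi : chart E1 M1) (psi : chart E2 M2) i j
  (p : Cr_dom (chart_cod phi) i) (q : Cr_dom (chart_cod psi) j), joint_at p q.

Lemma uncurry_in_Crs (g : Crmap r M1 (Crmap s M2 F)) :
  (fun p : M1 * M2 => g p.1 p.2) \in @Crs_pred R E1 E2 r s M1 M2 F.
Proof.
rewrite inE => phi psi Mphi Mpsi; apply: (uncurry_is_Crs (r := r)) => //.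
by move=> phi' Mphi'; exact: Crmap_in_chart.
Qed.

Definition uncurry_Crmap (g : Crmap r M1 (Crmap s M2 F)) : Crsmap r s M1 M2 F :=
  MkCrsmap (uncurry_in_Crs g).

Lemma uncurry_CrmapK : cancel uncurry_Crmap curry_Crsmap.
Proof. by move=> g; apply: Crmap_ext => x; apply: Crmap_ext. Qed.

Lemma curry_CrsmapK : cancel curry_Crsmap uncurry_Crmap.
Proof. by move=> f; apply: val_inj; apply/funext => -[x y]. Qed.

(** A compact set of the product lies in the product of its projections [K] and
[L], so that uniform closeness on [K] in the space of C^s-maps suffices. *)
Lemma uncurry_Crmap_continuous : continuous uncurry_Crmap.
Proof.
move=> g; apply: (@Crsmap_cvgP _ (nbhs g) uncurry_Crmap (uncurry_Crmap g) _).2.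
move=> phi psi i j Mphi Mpsi ir js.
apply: (@co_cvgP _ _ _ _ (nbhs g) _ _ _ _).2.
  by have [] := dij_is (Crsmap_in_charts (uncurry_Crmap g) Mphi Mpsi) ir js.
move=> K' U cK' U0.
pose K := (fun p : Crs_dom (chart_cod phi) (chart_cod psi) i j =>
  ((p.1.1, p.2.1) : Cr_dom (chart_cod phi) i)) @` K'.
pose L := (fun p : Crs_dom (chart_cod phi) (chart_cod psi) i j =>
  ((p.1.2, p.2.2) : Cr_dom (chart_cod psi) j)) @` K'.
have cK : compact K.
  apply: continuous_compact => //; apply: continuous_subspaceT => z.
  apply: (@cvg_pair_at _ (chart_cod phi) {ptws 'I_i -> E1}).
    apply: (@cvg_comp_at _ _ _ (nbhs z) fst fst); first exact: cvg_fst.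
    exact: cvg_fst.
  apply: (@cvg_comp_at _ _ _ (nbhs z) snd fst); first exact: cvg_snd.
  exact: cvg_fst.
have cL : compact L.
  apply: continuous_compact => //; apply: continuous_subspaceT => z.
  apply: (@cvg_pair_at _ (chart_cod psi) {ptws 'I_j -> E2}).
    apply: (@cvg_comp_at _ _ _ (nbhs z) fst snd); first exact: cvg_fst.
    exact: cvg_snd.
  apply: (@cvg_comp_at _ _ _ (nbhs z) snd snd); first exact: cvg_snd.
  exact: cvg_snd.
have W0 : nbhs (0 : Crmap s M2 F) [set A : Crmap s M2 F | forall q, L q ->
    U (dk (chart_cod psi) (in_chart psi A) j q -
       dk (chart_cod psi) (in_chart psi (0 : Crmap s M2 F)) j q)].
  have H := (@Crmap_cvgP R E2 F s M2 _ (nbhs (0 : Crmap s M2 F)) id 0 _).1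
    cvg_id psi j Mpsi js.
  exact: ((@co_cvgP _ _ _ _ (nbhs (0 : Crmap s M2 F)) _ _ _
    (Crmap_dk_continuous Mpsi js)).1 (H _) L U cL U0).
have H := (@Crmap_cvgP R E1 _ r M1 _ (nbhs g) id g _).1 cvg_id phi i Mphi ir.
have H2 := (@co_cvgP _ _ _ _ (nbhs g) _ _ _
  (Crmap_dk_continuous Mphi ir)).1 (H _) K _ cK W0.
apply: (@filterS _ (nbhs g) _ _ _ _ (H2 _ _)) => g' g'U z K'z.
have /= := g'U (z.1.1, z.2.1) (ex_intro2 _ _ z K'z erefl) (z.1.2, z.2.2)
  (ex_intro2 _ _ z K'z erefl).
rewrite Crmap_dkB// Crmap_dk0// subr0.
rewrite -{1}(uncurry_CrmapK g') -{1}(uncurry_CrmapK g) !dk_curry_Crsmap//.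
by case: z {K'z} => [[? ?] [? ?]].
Qed.

End ExponentialLaw.

(** The domains of differentials are products of a chart codomain with powers of
the modelling space; each condition passes to both kinds of factors. *)
Lemma joint_cases (R : realType) (E1 E2 : lcsType R)
    (M1 : manifold E1) (M2 : manifold E2)
    (abc : [\/ finite_dimensional E2 /\ with_corners M2,
               metrizable R E1 /\ metrizable R E2 |
               [/\ with_corners M1, with_corners M2,
                   hemicompact E1 /\ k_space E1 &
                   hemicompact E2 /\ k_space E2]])
    (phi : chart E1 M1) (psi : chart E2 M2) i j
    (p : Cr_dom (chart_cod phi) i) (q : Cr_dom (chart_cod psi) j) : joint_at p q.
Proof.
case: abc => [[fd wc]|[m1 m2]|[wc1 wc2 [h1 k1] [h2 k2]]].
- apply: compact_nbhs_joint; case: q => w u.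
  have H e := finite_dimensional_compact e fd.
  apply: compact_nbhs_prod; last exact: compact_nbhs_power.
  apply: (@corner_chart_at R E2 M2 (@compact_nbhs_at)) => //.
  by move=> S T z f D _ cf of_ cD; exact: (compact_nbhs_transport cf of_ cD).
- case: p q => [v w] [y u]; apply: first_countable_joint.
    apply: first_countable_prod; last first.
      by apply: first_countable_power; exact: metrizable_first_countable m1.
    by apply: first_countable_set; exact: metrizable_first_countable m1 _.
  apply: first_countable_prod; last first.
    by apply: first_countable_power; exact: metrizable_first_countable m2.
  by apply: first_countable_set; exact: metrizable_first_countable m2 _.
- case: p q => [v w] [y u]; apply: komega_joint.
  have H1 := hemicompact_k_komega h1 k1; have H2 := hemicompact_k_komega h2 k2.
  apply: komega_prod; [exact: uniform_regular|exact: uniform_regular|..].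
    apply: komega_prod; [exact: uniform_regular|exact: uniform_regular|..].
      apply: (@corner_chart_at R E1 M1 (@komega_at)) => //.
      by move=> S T z f D Dz cf of_ cD; exact: (komega_transport Dz cf of_ cD).
    exact: komega_power.
  apply: komega_prod; [exact: uniform_regular|exact: uniform_regular|..].
    apply: (@corner_chart_at R E2 M2 (@komega_at)) => //.
    by move=> S T z f D Dz cf of_ cD; exact: (komega_transport Dz cf of_ cD).
  exact: komega_power.
Qed.

Theorem corollary4p8 (R : realType) (E1 E2 F : lcsType R)
    (M1 : manifold E1) (M2 : manifold E2) (r s : option nat)
    (abc : [\/ finite_dimensional E2 /\ with_corners M2,
               metrizable R E1 /\ metrizable R E2 |
               [/\ with_corners M1, with_corners M2,
                   hemicompact E1 /\ k_space E1 &
                   hemicompact E2 /\ k_space E2]]) :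
  (exists Phi : {linear Crsmap r s M1 M2 F -> Crmap r M1 (Crmap s M2 F)},
     (forall f x y, Phi f x y = f (x, y)) /\ tvs_isomorphism Phi) /\
  (forall g : M1 -> Crmap s M2 F,
     is_Cr_map r g <-> is_Crs_map r s (fun p : M1 * M2 => g p.1 p.2)).
Proof.
have J := joint_cases abc.
split.
  exists (@curry_Crsmap R E1 E2 r s M1 M2 F); split=> //; split.
    exact: curry_Crsmap_continuous.
  exists (uncurry_Crmap J); split; [exact: curry_CrsmapK|exact: uncurry_CrmapK|].
  exact: uncurry_Crmap_continuous.
move=> g; split=> [Cg phi psi Mphi Mpsi|Cg].
  exact: (uncurry_is_Crs Cg).
have -> : g = curry_map Cg by apply/funext => x; apply: Crmap_ext.
by move=> phi Mphi; exact: curry_is_Cr.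
Qed.
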